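(* Assume the Kernel conjecture, i.e. $\ker(D_{<M})\cap\mathcal Z^{\mathfrak f}_M=\mathbb Q\,\zeta^{\mathfrak f}(M)$ for all $M\ge2$. Let $r,\ell\ge1$ and $N\ge2r+1$. Then for every $\xi\in(F_\ell\mathcal Z^{\mathfrak f}_{2,3})_N$ one has $D_{2r+1}(\xi)\in\mathcal L^{\mathfrak f}_{2r+1}\otimes F_{\ell-1}\mathcal Z^{\mathfrak f}_{2,3}$ and $D_{2r+1}(\xi)\in\mathbb Q\,\zeta^{\mathfrak f}_{2r+1}\otimes(F_{\ell-1}\mathcal Z^{\mathfrak f}_{2,3})_{N-2r-1}+\mathcal L^{\mathfrak f}_{2r+1}\otimes F_{\ell-2}\mathcal Z^{\mathfrak f}_{2,3}$; i.e. the induced map $D^{(\ell)}_{2r+1}:\operatorname{gr}^F_\ell(\mathcal Z^{\mathfrak f}_{2,3})_N\to\mathcal L^{\mathfrak f}_{2r+1}\otimes\operatorname{gr}^F_{\ell-1}(\mathcal Z^{\mathfrak f}_{2,3})_{N-2r-1}$ takes values in $\mathbb Q\,\zeta^{\mathfrak f}_{2r+1}\otimes\operatorname{gr}^F_{\ell-1}(\mathcal Z^{\mathfrak f}_{2,3})_{N-2r-1}$.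
   Context: Formal MZVs: $\mathcal X=\{x_0,x_1\}$, $\mathbb Q\langle\mathcal X\rangle$ free noncommutative polynomials (weight = number of letters), $ш$ shuffle product. $\mathcal Z^{\mathfrak f}=(\mathbb Q\langle\mathcal X\rangle,ш)/R$, $R$ the ideal generated by $x_0,x_1$ and $uш v-\iota(\iota^{-1}(u)*\iota^{-1}(v))$ for $u\in\mathbb Q\mathbf1+x_0\mathbb Q\langle\mathcal X\rangle x_1$, $v\in\mathbb Q\mathbf1+\mathbb Q\langle\mathcal X\rangle x_1$, with $\iota(y_{k_1}\cdots y_{k_d})=x_0^{k_1-1}x_1\cdots x_0^{k_d-1}x_1$ and $*$ the stuffle product ($y_iu*y_jv=y_i(u*y_jv)+y_j(y_iu*v)+y_{i+j}(u*v)$). $\zeta^{\mathfrak f}(k_1,\dots,k_d)$ is the class of $x_0^{k_1-1}x_1\cdots x_0^{k_d-1}x_1$; $\mathcal Z^{\mathfrak f}_N$ weight-$N$ part. $\mathcal Z^{\mathfrak f}_{2,3}=\operatorname{span}\{\zeta^{\mathfrak f}(k_1,\dots,k_d):k_i\in\{2,3\}\}$; $F_\ell\mathcal Z^{\mathfrak f}_{2,3}$ is spanned by those with at most $\ell$ indices equal to $3$ ($F_{-1}=0$), $\operatorname{gr}^F_\ell=F_\ell/F_{\ell-1}$, and subscripts denote weight components. $\mathcal A^{\mathfrak f}=\mathcal Z^{\mathfrak f}/(\zeta^{\mathfrak f}(2))$, $\alpha$ the projection; Goncharov coaction $\Delta_{\mathrm{Gon}}:\mathcal Z^{\mathfrak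 f}\to\mathcal A^{\mathfrak f}\otimes\mathcal Z^{\mathfrak f}$, $\zeta^{\mathfrak f}(w)\mapsto(\alpha\circ\zeta^{\mathfrak f}\otimes\zeta^{\mathfrak f})(\Delta_{\mathrm{Gon}}(w))$ with $\Delta_{\mathrm{Gon}}(\varepsilon_1\cdots\varepsilon_n)=\sum_k\sum_{0<i_1<\dots<i_k<n+1}\big(\mathop{ш}_{p=0}^kI(\varepsilon_{i_p};\varepsilon_{i_p+1}\cdots\varepsilon_{i_{p+1}-1};\varepsilon_{i_{p+1}})\big)\otimes\varepsilon_{i_1}\cdots\varepsilon_{i_k}$ ($i_0=0,i_{k+1}=n+1,\varepsilon_0=x_1,\varepsilon_{n+1}=x_0$; $I(x_1;f;x_0)=f$, $I(x_0;f;x_1)=S(f)$, $S(\varepsilon_1\cdots\varepsilon_m)=(-1)^m\varepsilon_m\cdots\varepsilon_1$, $I(\varepsilon;f;\varepsilon)$ = coefficient of $\mathbf1$ in $f$ times $\mathbf1$). $\mathcal L^{\mathfrak f}=\mathcal A^{\mathfrak f}_{>0}/(\mathcal A^{\mathfrak f}_{>0})^2$, $\pi_{2r+1}:\mathcal A^{\mathfrak f}_{>0}\to\mathcal L^{\mathfrak f}_{2r+1}$ the projection, $D_{2r+1}=(\pi_{2r+1}\otimes\mathrm{id})\circ(\Delta_{\mathrm{Gon}}-\mathbf1\otimes\mathrm{id})$, $D_{<M}=\bigoplus_{3\le2r+1<M}D_{2r+1}$, and $\zeta^{\mathfrak f}_{2r+1}=\pi_{2r+1}(\alpha(\zeta^{\mathfrak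 f}(2r+1)))$. *)

(* Defs.v *)
(* Formal MZVs modelled concretely:
   Q<X> = finite formal Q-linear combinations of words, represented as lists
   of (coefficient, word); two such lists denote the same polynomial iff they
   have the same coefficient function [coef].  Quotients (Z^f, A^f, L^f and
   tensor products of them) are modelled by the corresponding subspaces of
   lifts: an equation in a quotient is "difference lies in the kernel". *)
From mathcomp Require Import all_boot all_order all_algebra.
Set Implicit Arguments. Unset Strict Implicit. Unset Printing Implicit Defensive.
Import Order.TTheory GRing.Theory Num.Theory.
Local Open Scope ring_scope.

(* letters: false = x_0, true = x_1 *)
Definition word := seq bool.
Definition ncpoly := seq (rat * word).
Definition ncipoly := seq (rat * seq nat).            (* Q<Y>, Y = {y_k} *)
Definition nctens := seq (rat * (word * word)).

Definition coef (p : ncpoly) (w : word) : rat := \sum_(e <- p | e.2 == w) e.1.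
Definition coefT (t : nctens) (ww : word * word) : rat :=
  \sum_(e <- t | e.2 == ww) e.1.

Definition pone : ncpoly := [:: (1, [::])].
Definition pword (w : word) : ncpoly := [:: (1, w)].
Definition pscale (c : rat) (p : ncpoly) : ncpoly := [seq (c * e.1, e.2) | e <- p].
Definition psub (p q : ncpoly) : ncpoly := p ++ pscale (-1) q.
Definition tscale (c : rat) (t : nctens) : nctens := [seq (c * e.1, e.2) | e <- t].
Definition tsub (t u : nctens) : nctens := t ++ tscale (-1) u.

Definition homog (n : nat) (p : ncpoly) : Prop :=
  forall w, coef p w != 0 -> size w = n.
Definition posw (p : ncpoly) : Prop := forall w, coef p w != 0 -> (0 < size w)%N.

Fixpoint shw (u v : word) : seq word :=
  match u with
  | [::] => [:: v]
  | a :: u' =>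
    let fix aux (v : word) : seq word :=
      match v with
      | [::] => [:: u]
      | b :: v' => map (cons a) (shw u' v) ++ map (cons b) (aux v')
      end in aux v
  end.
Definition shuffle (p q : ncpoly) : ncpoly :=
  flatten [seq [seq (a.1 * b.1, w) | w <- shw a.2 b.2] | a <- p, b <- q].

(* stuffle product on index sequences (y_{k_1}...y_{k_d} <-> [:: k_1; ...; k_d]) *)
Fixpoint stw (u v : seq nat) : seq (seq nat) :=
  match u with
  | [::] => [:: v]
  | i :: u' =>
    let fix aux (v : seq nat) : seq (seq nat) :=
      match v with
      | [::] => [:: u]
      | j :: v' => map (cons i) (stw u' v) ++ map (cons j) (aux v')
                   ++ map (cons (i + j)%N) (stw u' v')
      end in aux v
  end.
Definition stuffle (p q : ncipoly) : ncipoly :=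
  flatten [seq [seq (a.1 * b.1, w) | w <- stw a.2 b.2] | a <- p, b <- q].

Definition iw (k : seq nat) : word :=
  flatten [seq rcons (nseq i.-1 false) true | i <- k].
(* inverse of iota on words in Q1 + Q<X>x1 (extended arbitrarily elsewhere) *)
Fixpoint iinv_aux (n : nat) (w : word) : seq nat :=
  match w with
  | [::] => [::]
  | false :: w' => iinv_aux n.+1 w'
  | true :: w' => n.+1 :: iinv_aux 0 w'
  end.
Definition iinv (w : word) : seq nat := iinv_aux 0 w.
Definition iota_lin (p : ncipoly) : ncpoly := [seq (e.1, iw e.2) | e <- p].
Definition iinv_lin (p : ncpoly) : ncipoly := [seq (e.1, iinv e.2) | e <- p].

Definition in_Q1_x0Xx1 (u : ncpoly) : Prop :=
  forall w, coef u w != 0 ->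
    (w == [::]) || ((head true w == false) && (last false w == true)).
Definition in_Q1_Xx1 (v : ncpoly) : Prop :=
  forall w, coef v w != 0 -> (w == [::]) || (last false w == true).

Definition Rgen (p : ncpoly) : Prop :=
  p = pword [:: false] \/ p = pword [:: true] \/
  exists u v, in_Q1_x0Xx1 u /\ in_Q1_Xx1 v /\
    p = psub (shuffle u v) (iota_lin (stuffle (iinv_lin u) (iinv_lin v))).

Definition ideal_of (G : ncpoly -> Prop) (p : ncpoly) : Prop :=
  exists s : seq (ncpoly * ncpoly), (forall x, x \in s -> G x.2) /\
    forall w, coef p w = coef (flatten [seq shuffle x.1 x.2 | x <- s]) w.

(* R ; p in R  <->  zeta^f(p) = 0 in Z^f *)
Definition Rideal : ncpoly -> Prop := ideal_of Rgen.

(* zeta^f(k) lifts to iw k; zeta^f(2) lifts to x0 x1 *)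
(* kernel of Q<X>_n -> L^f_n  (A^f = Z^f/(zeta^f(2)), L^f = A_{>0}/(A_{>0})^2):
   weight-n polynomials in R + (x0x1) + (positive-weight products) *)
Definition Lgen (p : ncpoly) : Prop :=
  Rgen p \/ p = pword (iw [:: 2%N]) \/
  exists a b, posw a /\ posw b /\ p = shuffle a b.
Definition kerL (n : nat) (p : ncpoly) : Prop := homog n p /\ ideal_of Lgen p.

Definition tensp (a b : ncpoly) : nctens :=
  [seq (x.1 * y.1, (x.2, y.2)) | x <- a, y <- b].
Definition tsum (s : seq (ncpoly * ncpoly)) : nctens :=
  flatten [seq tensp x.1 x.2 | x <- s].

(* kernel of Q<X>_n (x) Q<X> -> L^f_n (x) Z^f *)
Definition Kn (n : nat) (t : nctens) : Prop :=
  exists s : seq (ncpoly * ncpoly), (forall x, x \in s -> kerL n x.1 \/ Rideal x.2) /\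
    forall ww, coefT t ww = coefT (tsum s) ww.

Fixpoint masks (n : nat) : seq bitseq :=
  if n is n'.+1 then [seq b :: m | b <- [:: false; true], m <- masks n'] else [:: [::]].

(* segments (eps_{i_p}; eps_{i_p+1} ... eps_{i_{p+1}-1}; eps_{i_{p+1}}) *)
Fixpoint segs (prev : bool) (acc : word) (w : word) (m : bitseq)
  : seq (bool * word * bool) :=
  match w, m with
  | a :: w', b :: m' =>
      if b then (prev, acc, a) :: segs a [::] w' m'
      else segs prev (rcons acc a) w' m'
  | _, _ => [:: (prev, acc, false)]
  end.

Definition Iint (a : bool) (f : word) (b : bool) : ncpoly :=
  if a == b then (if f == [::] then pone else [::])
  else if a then [:: (1, f)]
  else [:: ((-1) ^+ size f, rev f)].                          (* I(x0;f;x1) = S(f) *)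

Definition gon_word (w : word) : nctens :=
  flatten [seq tensp (foldr (fun s acc => shuffle (Iint s.1.1 s.1.2 s.2) acc) pone
                          (segs true [::] w m))
                     (pword (mask m w)) | m <- masks (size w)].
Definition gon (p : ncpoly) : nctens := flatten [seq tscale e.1 (gon_word e.2) | e <- p].

(* lift of D_{2r+1}: (weight-(2r+1) projection (x) id) o (Delta_Gon - 1 (x) id) *)
Definition Dodd (r : nat) (p : ncpoly) : nctens :=
  [seq e <- tsub (gon p) (tensp pone p) | size e.2.1 == (2 * r + 1)%N].

Definition zeta_lift (M : nat) : ncpoly := pword (iw [:: M]).

Definition KernelConjecture : Prop :=
  forall (M : nat), (2 <= M)%N -> forall u : ncpoly, homog M u ->
    ((forall r : nat, (3 <= 2 * r + 1 < M)%N -> Kn (2 * r + 1) (Dodd r u)) <->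
     exists c : rat, Rideal (psub u (pscale c (zeta_lift M)))).

Definition Fidx (m : int) (k : seq nat) : bool :=
  all (fun i => (i == 2%N) || (i == 3%N)) k && ((count_mem 3%N k)%:Z <= m).

(* lift of an element of (F_m Z_{2,3})_N *)
Definition inFN (m : int) (N : nat) (u : ncpoly) : Prop :=
  exists s : ncipoly, (forall x, x \in s -> Fidx m x.2 && (sumn x.2 == N)) /\
    u = iota_lin s.

(* elements of L^f_n (x) F_m Z_{2,3}, as lifts *)
Definition LtensF (n : nat) (m : int) (s : seq (ncpoly * seq nat)) : nctens :=
  tsum [seq (x.1, pword (iw x.2)) | x <- s].
Definition LtensF_ok (n : nat) (m : int) (s : seq (ncpoly * seq nat)) : Prop :=
  forall x, x \in s -> homog n x.1 /\ Fidx m x.2.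

(* Main.v *)
Require Import Defs.
From mathcomp Require Import all_boot all_order all_algebra.
From mathcomp Require Import zify ring.
Import Order.TTheory GRing.Theory Num.Theory.
Local Open Scope ring_scope.

(* Modulo products the antipode is -id, so in odd weight D_(2r+1) becomes
     w |-> sum over w = u s v, |s| = 2r+1, of (phi(a) - phi(b)) s (x) uv,
   where a, b are the letters around s, phi(x1) = 1 and phi(x0) = 0; this is a
   derivation for the shuffle product of the right-hand factor.  On a
   concatenation of blocks x0 x1 and x0 x0 x1 a cut with a <> b removes an odd
   number of adjacent pairs x0 x0, i.e. of indices 3, and leaves a word of the
   same kind.  If it removes at least three, the term lies in F_(l-3).  If it
   removes one, then modulo products s is a combination of words
   zeta(2,..,2,3,2,..,2), and these are multiples of zeta(2r+1): by induction
   on r a combination of the products zeta(2t+1) zeta(2,..,2) has the same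
   D_(2t+1), t < r, and the kernel conjecture applies to the difference. *)

Arguments shuffle : simpl never.
Arguments pscale : simpl never.
Arguments tscale : simpl never.
Arguments psub : simpl never.
Arguments tsub : simpl never.
Arguments tensp : simpl never.
Arguments tsum : simpl never.

(* Lists of (coefficient, basis element) are compared through all linear forms. *)
Definition ev (A : Type) (f : A -> rat) (t : seq (rat * A)) : rat :=
  \sum_(e <- t) e.1 * f e.2.
Arguments ev {A} f t.
Definition teq (A : Type) (t u : seq (rat * A)) : Prop := forall f, ev f t = ev f u.
Arguments teq {A} t u.

Section Ev.
Variable A : Type.
Implicit Types (f g : A -> rat) (t u : seq (rat * A)).

Lemma ev_nil f : ev f [::] = 0.
Proof. by rewrite /ev big_nil. Qed.
Lemma ev_cons f e t : ev f (e :: t) = e.1 * f e.2 + ev f t.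
Proof. by rewrite /ev big_cons. Qed.
Lemma ev1 f c x : ev f [:: (c, x)] = c * f x.
Proof. by rewrite ev_cons ev_nil addr0. Qed.
Lemma ev_cat f t u : ev f (t ++ u) = ev f t + ev f u.
Proof. by rewrite /ev big_cat. Qed.
Lemma ev_scale f c t : ev f [seq (c * e.1, e.2) | e <- t] = c * ev f t.
Proof. by rewrite /ev big_map big_distrr; apply: eq_bigr => e _ /=; rewrite mulrA. Qed.
Lemma ev_flatten (B : Type) f (F : B -> seq (rat * A)) (s : seq B) :
  ev f (flatten [seq F x | x <- s]) = \sum_(x <- s) ev f (F x).
Proof. by rewrite /ev big_flatten big_map. Qed.
Lemma ev_filter f (P : A -> bool) t :
  ev f [seq e <- t | P e.2] = ev (fun x => (P x)%:R * f x) t.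
Proof.
rewrite /ev big_filter big_mkcond; apply: eq_bigr => e _.
by case: (P e.2); rewrite ?mul1r // mul0r mulr0.
Qed.
Lemma eq_ev f g t : f =1 g -> ev f t = ev g t.
Proof. by move=> H; apply: eq_bigr => e _; rewrite H. Qed.
Lemma evD f g t : ev (fun x => f x + g x) t = ev f t + ev g t.
Proof. by rewrite /ev -big_split; apply: eq_bigr => e _; rewrite mulrDr. Qed.
Lemma evZ c f t : ev (fun x => c * f x) t = c * ev f t.
Proof. by rewrite /ev big_distrr; apply: eq_bigr => e _ /=; ring. Qed.
Lemma ev0 t : ev (fun _ => 0) t = 0.
Proof. by rewrite /ev big1 // => e _; rewrite mulr0. Qed.
End Ev.

Lemma ev_exchange (A B : Type) (f : A -> B -> rat) t u :
  ev (fun x => ev (f x) u) t = ev (fun y => ev (f^~ y) t) u.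
Proof.
elim: t => [|e t IH]; first by rewrite ev_nil -(ev0 _ u); apply: eq_ev => y; rewrite ev_nil.
by rewrite ev_cons IH -evZ -evD; apply: eq_ev => y; rewrite ev_cons.
Qed.

Lemma ev_pscale f c p : ev f (pscale c p) = c * ev f p.
Proof. exact: ev_scale. Qed.
Lemma ev_tscale f c p : ev f (tscale c p) = c * ev f p.
Proof. exact: ev_scale. Qed.
Lemma ev_psub f p q : ev f (psub p q) = ev f p - ev f q.
Proof. by rewrite ev_cat ev_scale mulN1r. Qed.
Lemma ev_tsub f p q : ev f (tsub p q) = ev f p - ev f q.
Proof. by rewrite ev_cat ev_scale mulN1r. Qed.
Lemma ev_pword f w : ev f (pword w) = f w.
Proof. by rewrite ev1 mul1r. Qed.
Lemma ev_tensp f a b : ev f (tensp a b) = ev (fun u => ev (fun v => f (u, v)) b) a.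
Proof.
rewrite /ev /tensp big_flatten big_map; apply: eq_bigr => x _; rewrite big_map.
by rewrite big_distrr; apply: eq_bigr => y _ /=; ring.
Qed.
Lemma ev_tsum f s : ev f (tsum s) = \sum_(x <- s) ev f (tensp x.1 x.2).
Proof. exact: ev_flatten. Qed.

Lemma coefE p w : coef p w = ev (fun v => (v == w)%:R) p.
Proof.
rewrite /coef /ev big_mkcond; apply: eq_bigr => e _.
by case: eqP; rewrite ?mulr1 ?mulr0.
Qed.
Lemma coefTE p w : coefT p w = ev (fun v => (v == w)%:R) p.
Proof.
rewrite /coefT /ev big_mkcond; apply: eq_bigr => e _.
by case: eqP; rewrite ?mulr1 ?mulr0.
Qed.

(** * Shuffles *)

Definition sum_shw (u v : word) (f : word -> rat) : rat := \sum_(w <- shw u v) f w.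

Lemma sum_shw0s v f : sum_shw [::] v f = f v.
Proof. by rewrite /sum_shw /= big_seq1. Qed.
Lemma sum_shws0 u f : sum_shw u [::] f = f u.
Proof. by rewrite /sum_shw; case: u => [|a u] /=; rewrite big_seq1. Qed.
Lemma sum_shw_cons a u b v f : sum_shw (a :: u) (b :: v) f =
  sum_shw u (b :: v) (fun w => f (a :: w)) + sum_shw (a :: u) v (fun w => f (b :: w)).
Proof. by rewrite /sum_shw /= big_cat /= !big_map. Qed.
Lemma eq_sum_shw u v f g : f =1 g -> sum_shw u v f = sum_shw u v g.
Proof. by move=> H; apply: eq_bigr => e _; rewrite H. Qed.
Lemma sum_shwC u v f : sum_shw u v f = sum_shw v u f.
Proof.
elim: u v f => [|a u IHu] v f; first by rewrite sum_shw0s sum_shws0.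
elim: v f => [|b v IHv] f; first by rewrite sum_shw0s sum_shws0.
by rewrite !sum_shw_cons IHu IHv addrC.
Qed.
Lemma sum_shwD u v f g : sum_shw u v (fun w => f w + g w) = sum_shw u v f + sum_shw u v g.
Proof. exact: big_split. Qed.
Lemma sum_shwZ u v c f : sum_shw u v (fun w => c * f w) = c * sum_shw u v f.
Proof. by rewrite /sum_shw big_distrr. Qed.
Lemma ev_shuffle f p q :
  ev f (shuffle p q) = ev (fun u => ev (fun v => sum_shw u v f) q) p.
Proof.
rewrite /ev /shuffle !big_flatten big_map; apply: eq_bigr => x _; rewrite big_map.
rewrite big_distrr; apply: eq_bigr => y _ /=.
by rewrite big_map /sum_shw mulrA big_distrr.
Qed.
Lemma size_shw u v w : w \in shw u v -> size w = (size u + size v)%N.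
Proof.
elim: u v w => [|a u IHu] v w; first by rewrite /= inE => /eqP->.
elim: v w => [|b v IHv] w; first by rewrite /= inE addn0 => /eqP->.
rewrite mem_cat => /orP[] /mapP[z Hz ->] /=.
  by rewrite (IHu _ _ Hz).
by rewrite (IHv _ Hz) /= addnS.
Qed.

(** A condition on the listed terms instead of the coefficient function: it implies [homog] and
    passes through list operations with no account of cancellation. *)
Definition allsz (n : nat) (p : ncpoly) := all (fun e => size e.2 == n) p.

Lemma coef_support p w : coef p w != 0 -> exists2 e, e \in p & e.2 = w.
Proof.
move=> H; suff /hasP[e He /eqP <-] : has (fun e => e.2 == w) p by exists e.
apply: contraNT H => /hasPn H; rewrite /coef big_seq_cond big1 // => e /andP[/H].
by move/negbTE->.
Qed.
Lemma allsz_homog n p : allsz n p -> homog n p.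
Proof. by move=> /allP H w /coef_support[e /H /eqP ? <-]. Qed.
Lemma allsz_posw n p : (0 < n)%N -> allsz n p -> posw p.
Proof. by move=> n0 /allsz_homog H w /H ->. Qed.
Lemma allsz_shuffle m n p q : allsz m p -> allsz n q -> allsz (m + n) (shuffle p q).
Proof.
move=> /allP Hp /allP Hq; apply/allP => e /flattenP[s /allpairsP[[a b] [/Hp Ha /Hq Hb ->]]].
by move=> /mapP[w Hw ->] /=; rewrite (size_shw _ _ _ Hw) (eqP Ha) (eqP Hb).
Qed.
Lemma allsz_cat n p q : allsz n (p ++ q) = allsz n p && allsz n q.
Proof. exact: all_cat. Qed.
Lemma allsz_scale n c p : allsz n (pscale c p) = allsz n p.
Proof. by rewrite /allsz all_map. Qed.
Lemma allsz_sub n p q : allsz n (psub p q) = allsz n p && allsz n q.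
Proof. by rewrite allsz_cat allsz_scale. Qed.
Lemma allsz_word n c w : allsz n [:: (c, w)] = (size w == n).
Proof. by rewrite /allsz /= andbT. Qed.

(** * Shuffle ideals *)

Section Ideal.
Variable G : ncpoly -> Prop.

Lemma ideal_eq p q : teq p q -> ideal_of G p -> ideal_of G q.
Proof. by move=> E [s [Hs H]]; exists s; split=> // w; rewrite -H !coefE E. Qed.
Lemma ideal_mul a g : G g -> ideal_of G (shuffle a g).
Proof.
move=> Gg; exists [:: (a, g)]; split=> [x|w]; first by rewrite inE => /eqP->.
by rewrite /= cats0.
Qed.
Lemma ideal_cat p q : ideal_of G p -> ideal_of G q -> ideal_of G (p ++ q).
Proof.
move=> [s [Hs H]] [s' [Hs' H']]; exists (s ++ s'); split=> [x|w].
  by rewrite mem_cat => /orP[/Hs|/Hs'].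
by move: (H w) (H' w); rewrite map_cat flatten_cat !coefE !ev_cat => -> ->.
Qed.
Lemma ideal_gen g : G g -> ideal_of G g.
Proof.
move=> /(ideal_mul pone); apply: ideal_eq => f.
by rewrite ev_shuffle ev1 mul1r; apply: eq_ev => w; rewrite sum_shw0s.
Qed.
Lemma ideal_scale c p : ideal_of G p -> ideal_of G (pscale c p).
Proof.
move=> [s [Hs H]]; exists [seq (pscale c x.1, x.2) | x <- s]; split=> [x|w].
  by move=> /mapP[y /Hs Hy ->].
move: (H w); rewrite !coefE ev_pscale => ->.
rewrite -map_comp !ev_flatten big_distrr; apply: eq_bigr => x _ /=.
by rewrite !ev_shuffle ev_pscale.
Qed.
Lemma ideal_nil : ideal_of G [::].
Proof. by exists [::]. Qed.
Lemma ideal_flatten (B : eqType) (F : B -> ncpoly) (s : seq B) :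
  (forall x, x \in s -> ideal_of G (F x)) -> ideal_of G (flatten [seq F x | x <- s]).
Proof.
elim: s => [|x s IH] H /=; first exact: ideal_nil.
apply: ideal_cat; first by apply: H; rewrite mem_head.
by apply: IH => y Hy; apply: H; rewrite inE Hy orbT.
Qed.
End Ideal.

(** * The kernels of the projections to L and to L (x) Q<X> *)

Definition inL := ideal_of Lgen.

Lemma inL_prod a b : posw a -> posw b -> inL (shuffle a b).
Proof. by move=> Ha Hb; apply: ideal_gen; right; right; exists a, b. Qed.

Lemma kerLP n p : allsz n p -> inL p -> kerL n p.
Proof. by move=> /allsz_homog. Qed.

(* The kernel of Q<X>_n (x) Q<X> -> L_n (x) Q<X>: unlike [Kn] it is stable under
   every linear map of the right-hand factor. *)
Definition inK (n : nat) (t : nctens) : Prop :=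
  exists s : seq (ncpoly * ncpoly), (forall x, x \in s -> kerL n x.1) /\ teq t (tsum s).

Definition mapr (g : word -> ncpoly) (t : nctens) : nctens :=
  flatten [seq [seq (e.1 * c.1, (e.2.1, c.2)) | c <- g e.2.2] | e <- t].

Lemma ev_mapr f g t :
  ev f (mapr g t) = ev (fun x => ev (fun w => f (x.1, w)) (g x.2)) t.
Proof.
rewrite ev_flatten; apply: eq_bigr => e _; rewrite /ev big_map big_distrr.
by apply: eq_bigr => c _ /=; rewrite mulrA.
Qed.

Definition consr (x : bool) := mapr (fun w => pword (x :: w)).
Lemma ev_consr f x t : ev f (consr x t) = ev (fun y => f (y.1, x :: y.2)) t.
Proof. by rewrite ev_mapr; apply: eq_ev => y; rewrite ev_pword. Qed.
Definition shr (v : word) := mapr (fun w => shuffle (pword w) (pword v)).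
Lemma ev_shr f v t : ev f (shr v t) = ev (fun y => sum_shw y.2 v (fun w => f (y.1, w))) t.
Proof. by rewrite ev_mapr; apply: eq_ev => y; rewrite ev_shuffle !ev_pword. Qed.

Section K.
Variable n : nat.
Notation inK := (inK n).

Lemma inK_eq t u : teq t u -> inK t -> inK u.
Proof. by move=> E [s [Hs H]]; exists s; split=> // f; rewrite -E. Qed.
Lemma inK_nil : inK [::].
Proof. by exists [::]. Qed.
Lemma inK_cat t u : inK t -> inK u -> inK (t ++ u).
Proof.
move=> [s [Hs H]] [s' [Hs' H']]; exists (s ++ s'); split=> [x|f].
  by rewrite mem_cat => /orP[/Hs|/Hs'].
by rewrite ev_cat H H' /tsum map_cat flatten_cat ev_cat.
Qed.
Lemma inK_tens a b : kerL n a -> inK (tensp a b).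
Proof.
move=> Ha; exists [:: (a, b)]; split=> [x|f]; first by rewrite inE => /eqP->.
by rewrite /tsum /= cats0.
Qed.
Lemma inK_mapr g t : inK t -> inK (mapr g t).
Proof.
move=> [s [Hs H]]; exists [seq (x.1, flatten [seq pscale e.1 (g e.2) | e <- x.2]) | x <- s].
split=> [x /mapP[y /Hs Hy ->] //|f].
rewrite ev_mapr H !ev_tsum big_map; apply: eq_bigr => x _ /=.
rewrite !ev_tensp; apply: eq_ev => u; rewrite ev_flatten.
by apply: eq_bigr => v _; rewrite ev_pscale.
Qed.
Lemma inK_scale c t : inK t -> inK (tscale c t).
Proof.
move=> /(inK_mapr (fun w => [:: (c, w)])); apply: inK_eq => f.
rewrite ev_mapr ev_tscale -evZ; apply: eq_ev => -[u v]; exact: ev1.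
Qed.
Lemma inK_flatten (B : eqType) (F : B -> nctens) (s : seq B) :
  (forall x, x \in s -> inK (F x)) -> inK (flatten [seq F x | x <- s]).
Proof.
elim: s => [|x s IH] H /=; first exact: inK_nil.
apply: inK_cat; first by apply: H; rewrite mem_head.
by apply: IH => y Hy; apply: H; rewrite inE Hy orbT.
Qed.
Lemma inK_seq (t : nctens) : (forall e, e \in t -> inK [:: e]) -> inK t.
Proof.
move=> /(inK_flatten _ (fun e => [:: e])); rewrite (_ : flatten _ = t) //.
by elim: t => //= e t ->.
Qed.
Lemma inK_Kn t : inK t -> Kn n t.
Proof.
move=> [s [Hs H]]; exists s; split=> [x /Hs|ww]; first by left.
by rewrite !coefTE H.
Qed.
End K.

(** * The coaction modulo products *)

Lemma posw_word w c : (0 < size w)%N -> posw [:: (c, w)].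
Proof. by move=> H; apply: (allsz_posw (size w)) => //; rewrite allsz_word. Qed.

Lemma inL_trans q p r : inL (psub p q) -> inL (psub q r) -> inL (psub p r).
Proof.
move=> H1 H2; apply: ideal_eq (ideal_cat _ _ _ H1 H2) => f.
by rewrite ev_cat !ev_psub; ring.
Qed.

(* For g = [::] this is the convolution of the antipode with the identity: the sum
   over f = f1 f2 of (-1)^|f1| (rev f1) sh f2, which telescopes to 0. *)
Fixpoint antipode_sum (g f : word) : ncpoly :=
  shuffle (pword g) (pword f) ++
  if f is x :: f' then pscale (-1) (antipode_sum (x :: g) f') else [::].

Lemma antipode_sum_cons g x f : antipode_sum g (x :: f) =
  shuffle (pword g) (pword (x :: f)) ++ pscale (-1) (antipode_sum (x :: g) f).
Proof. by []. Qed.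

Lemma ev_antipode_sum0 F g : ev F (antipode_sum g [::]) = F g.
Proof. by rewrite ev_cat ev_shuffle !ev_pword ev_nil addr0 sum_shws0. Qed.

(** Split each shuffle by its first letter: the words beginning with the head of [f] cancel against
    the next term of the alternating sum. *)
Lemma ev_antipode_sum F y g f :
  ev F (antipode_sum (y :: g) f) = sum_shw g f (fun w => F (y :: w)).
Proof.
elim: f y g => [|x f IH] y g; first by rewrite ev_antipode_sum0 sum_shws0.
by rewrite antipode_sum_cons ev_cat ev_shuffle !ev_pword ev_pscale IH sum_shw_cons; ring.
Qed.

(** Every term but the last is a shuffle of two nonempty words. *)
Lemma antipode_sum_mod g f : (0 < size g)%N ->
  inL (psub (antipode_sum g f) [:: ((-1) ^+ size f, catrev f g)]).
Proof.
elim: f g => [|x f IH] g g0.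
  apply: ideal_eq (ideal_nil Lgen) => F.
  by rewrite ev_psub ev_antipode_sum0 ev_nil ev1 expr0 /=; ring.
have H1 : inL (shuffle (pword g) (pword (x :: f))) by apply: inL_prod; apply: posw_word.
apply: ideal_eq (ideal_cat _ _ _ H1 (ideal_scale _ (-1) _ (IH (x :: g) isT))) => F.
by rewrite ev_psub antipode_sum_cons !ev_cat !ev_pscale ev_psub !ev1 exprS /=; ring.
Qed.

(** For [g] a single letter the alternating sum is computed in two ways: telescoping leaves the word
    itself, and modulo products only its signed reversal remains. *)
Lemma rev_mod f : (0 < size f)%N ->
  inL (psub [:: ((-1) ^+ size f, rev f)] [:: (-1, f)]).
Proof.
case: f => // x f _.
apply: ideal_eq (antipode_sum_mod [:: x] f isT) => F.
rewrite !ev_psub ev_antipode_sum sum_shw0s !ev1 /rev /= exprS; ring.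
Qed.

Lemma Iint_mod a f b : (0 < size f)%N ->
  inL (psub (Iint a f b) [:: (a%:R - b%:R, f)]).
Proof.
move=> f0; have H0 := ideal_nil Lgen; rewrite /Iint; case: eqP => [->|].
  case: eqP f0 => [-> //|_ _]; apply: ideal_eq H0 => F.
  by rewrite ev_psub ev_nil ev1; ring.
case: a b => [] [] // _; last first.
  by apply: ideal_eq (rev_mod f f0) => F; rewrite !ev_psub !ev1; ring.
by apply: ideal_eq H0 => F; rewrite ev_psub !ev1 ev_nil; ring.
Qed.

Lemma allsz_Iint a f b : allsz (size f) (Iint a f b).
Proof.
rewrite /Iint; case: ifP => _; last by case: a; rewrite allsz_word ?size_rev.
by case: eqP => [->|].
Qed.

Section Cuts.
Variable n : nat.

(* The coefficient is that of I(c; take n w; b) = (phi(c) - phi(b)) (take n w) modulo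
   products, b being the next letter, or the final x0 when the cut exhausts w. *)
Definition prefix_cut (c : bool) (w : word) : nctens :=
  if (n <= size w)%N then
    [:: (c%:R - (head false (drop n w))%:R, (take n w, drop n w))] else [::].

Fixpoint cuts (c : bool) (w : word) : nctens :=
  if w is x :: w' then consr x (cuts x w') ++ prefix_cut c w else [::].

Definition cuts_lin (p : ncpoly) : nctens :=
  flatten [seq tscale e.1 (cuts true e.2) | e <- p].

Definition left_wt (k : nat) (t : nctens) : nctens := [seq e <- t | size e.2.1 == k].

Lemma ev_left_wt k f t : ev f (left_wt k t) = ev (fun x => (size x.1 == k)%:R * f x) t.
Proof. exact: (ev_filter _ f (fun x : word * word => size x.1 == k)). Qed.

Definition left_factor (p : bool) (acc w : word) (m : bitseq) : ncpoly :=
  foldr (fun s acc => shuffle (Iint s.1.1 s.1.2 s.2) acc) pone (segs p acc w m).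
(* The part of [gon_word] contributed by a tail w, when acc is the segment being
   read after the last kept letter p. *)
Definition gon_from (p : bool) (acc w : word) : nctens :=
  flatten [seq tensp (left_factor p acc w m) (pword (mask m w)) | m <- masks (size w)].

(* [F] multiplies the left factor, [x] is prepended to the right factor. *)
Definition lshuffle (F : ncpoly) (x : bool) (t : nctens) : nctens :=
  flatten [seq tensp (shuffle F [:: (e.1, e.2.1)]) (pword (x :: e.2.2)) | e <- t].

Lemma ev_lshuffle f F x t : ev f (lshuffle F x t) =
  ev (fun y => ev (fun a => sum_shw a y.1 (fun z => f (z, x :: y.2))) F) t.
Proof.
rewrite ev_flatten; apply: eq_bigr => e _.
rewrite ev_tensp ev_shuffle -evZ; apply: eq_ev => a; rewrite ev1; congr (_ * _).
by apply: eq_sum_shw => z; rewrite ev_pword.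
Qed.

Lemma gon_from_nil p acc : teq (gon_from p acc [::]) (tensp (Iint p acc false) (pword [::])).
Proof.
move=> f; rewrite /gon_from /masks /= cats0 !ev_tensp ev_shuffle; apply: eq_ev => u.
by rewrite ev1 mul1r sum_shws0.
Qed.

(** The letter [x] either joins the current segment or is kept, which closes that segment and opens
    an empty one. *)
Lemma gon_from_cons p acc x w : teq (gon_from p acc (x :: w))
  (gon_from p (rcons acc x) w ++ lshuffle (Iint p acc x) x (gon_from x [::] w)).
Proof.
move=> f; rewrite ev_cat /gon_from /= cats0 map_cat flatten_cat ev_cat -!map_comp.
congr (_ + _); rewrite ev_lshuffle !ev_flatten; apply: eq_bigr => m _ /=.
rewrite !ev_tensp ev_shuffle ev_exchange; apply: eq_ev => u.
by rewrite ev_pword; apply: eq_ev => a; apply: eq_sum_shw => z; rewrite ev_pword.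
Qed.

Lemma Iint_nil p b : Iint p [::] b = pone.
Proof. by case: p; case: b. Qed.

Lemma ev_lshuffle1 f x t : ev f (lshuffle pone x t) = ev f (consr x t).
Proof.
by rewrite ev_lshuffle ev_consr; apply: eq_ev => y; rewrite ev1 mul1r sum_shw0s.
Qed.

Lemma left_wt_lshuffle s F k x t : allsz s F -> teq (left_wt k (lshuffle F x t))
  (if (s <= k)%N then lshuffle F x (left_wt (k - s) t) else [::]).
Proof.
move=> /allP HF f.
have -> : ev f (left_wt k (lshuffle F x t)) = ev (fun y => (s + size y.1 == k)%:R *
    ev (fun a => sum_shw a y.1 (fun z => f (z, x :: y.2))) F) t.
  rewrite ev_left_wt ev_lshuffle; apply: eq_ev => y; rewrite -evZ.
  apply: eq_big_seq => e /HF /eqP es; congr (_ * _); rewrite -sum_shwZ.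
  by apply: eq_big_seq => z /size_shw -> /=; rewrite es.
case: leqP => sk; last first.
  by rewrite ev_nil -[RHS](ev0 _ t); apply: eq_ev => y; rewrite (gtn_eqF (ltn_addr _ sk)) mul0r.
rewrite ev_lshuffle ev_left_wt; apply: eq_ev => y.
by rewrite -{1}(subnKC sk) eqn_add2l.
Qed.

Lemma ev_gon_from_cons f k p acc x w : ev f (left_wt k (gon_from p acc (x :: w))) =
  ev f (left_wt k (gon_from p (rcons acc x) w)) +
  ev f (left_wt k (lshuffle (Iint p acc x) x (gon_from x [::] w))).
Proof. by rewrite !ev_left_wt gon_from_cons ev_cat. Qed.

Lemma left_wt_gon_from_lt k p acc w : (k < size acc)%N -> teq (left_wt k (gon_from p acc w)) [::].
Proof.
elim: w p acc => [|x w IH] p acc ks f.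
  rewrite ev_left_wt gon_from_nil ev_tensp ev_nil [LHS]big_seq big1 // => e.
  have /allP HI := allsz_Iint p acc false; move=> /HI /eqP es;
  by rewrite ev_pword /= es gtn_eqF // mul0r !mulr0.
rewrite ev_gon_from_cons IH; last by rewrite size_rcons ltnS ltnW.
by rewrite (left_wt_lshuffle (size acc)) ?allsz_Iint // leqNgt ks /= ev_nil addr0.
Qed.

(** An empty left factor means that every letter is kept. *)
Lemma left_wt0_gon_from p w : teq (left_wt 0 (gon_from p [::] w)) [:: (1, ([::], w))].
Proof.
elim: w p => [|x w IH] p f.
  by rewrite ev_left_wt gon_from_nil ev_tensp Iint_nil ev1 ev_pword ev1 mul1r.
rewrite ev_gon_from_cons left_wt_gon_from_lt // ev_nil add0r Iint_nil.
by rewrite (left_wt_lshuffle 0) //= ev_lshuffle1 ev_consr IH !ev1.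
Qed.

Definition eqK (t u : nctens) : Prop := inK n (tsub t u).

Lemma eqK_teq t u : teq t u -> eqK t u.
Proof.
by move=> H; apply: inK_eq (inK_nil n) => f; rewrite ev_tsub H subrr ev_nil.
Qed.
Lemma eqK_trans t u v : eqK t u -> eqK u v -> eqK t v.
Proof.
move=> H1 H2; apply: inK_eq (inK_cat _ _ _ H1 H2) => f.
by rewrite ev_cat !ev_tsub; ring.
Qed.
Lemma eqK_cat t u t' u' : eqK t u -> eqK t' u' -> eqK (t ++ t') (u ++ u').
Proof.
move=> H1 H2; apply: inK_eq (inK_cat _ _ _ H1 H2) => f.
by rewrite !(ev_cat, ev_tsub); ring.
Qed.
Lemma eqK_scale c t u : eqK t u -> eqK (tscale c t) (tscale c u).
Proof.
move=> H; apply: inK_eq (inK_scale _ c _ H) => f.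
by rewrite !(ev_tscale, ev_tsub); ring.
Qed.
Lemma eqK_mapr g t u : eqK t u -> eqK (mapr g t) (mapr g u).
Proof.
move=> H; apply: inK_eq (inK_mapr _ g _ H) => f.
by rewrite !(ev_mapr, ev_tsub).
Qed.
Lemma eqK_flatten (B : eqType) (F F' : B -> nctens) (s : seq B) :
  (forall x, x \in s -> eqK (F x) (F' x)) ->
  eqK (flatten [seq F x | x <- s]) (flatten [seq F' x | x <- s]).
Proof.
elim: s => [|x s IH] H; first exact: eqK_teq.
apply: eqK_cat; first by apply: H; rewrite mem_head.
by apply: IH => y Hy; apply: H; rewrite inE Hy orbT.
Qed.
Lemma eqK_inK t : inK n t -> eqK t [::].
Proof. by apply: inK_eq => f; rewrite ev_tsub ev_nil subr0. Qed.
Lemma eqK_tens a a' b : allsz n a -> allsz n a' -> inL (psub a a') ->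
  eqK (tensp a b) (tensp a' b).
Proof.
move=> Ha Ha' H; have K : kerL n (psub a a') by apply: kerLP; rewrite ?allsz_sub ?Ha.
by apply: inK_eq (inK_tens _ _ b K) => f; rewrite ev_tsub !ev_tensp ev_psub.
Qed.

(** The only term in which the segment begun by [acc] makes up the whole left factor: it runs on to
    length [n], and every later letter is kept. *)
Definition open_cut (p : bool) (acc w : word) : nctens :=
  let k := (n - size acc)%N in
  if (size acc <= n <= size acc + size w)%N then
    [:: (p%:R - (head false (drop k w))%:R, (acc ++ take k w, drop k w))] else [::].

(** A left factor with two nonempty segments is a product, so modulo products a single segment of
    length [n] is cut out. The second half, for a segment already begun, carries the induction. *)
Lemma left_wt_gon_from (n0 : (0 < n)%N) w :
  (forall p, eqK (left_wt n (gon_from p [::] w)) (cuts p w)) /\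
  (forall p acc, (0 < size acc)%N -> eqK (left_wt n (gon_from p acc w)) (open_cut p acc w)).
Proof.
elim: w => [|x w [IH1 IH2]]; split=> [p|p acc s0].
- apply: eqK_teq => f; rewrite ev_left_wt gon_from_nil ev_tensp Iint_nil ev1 ev_pword ev_nil.
  by rewrite ltn_eqF // !mul0r mulr0.
- apply: eqK_trans (left_wt n (tensp (Iint p acc false) (pword [::]))) _ _ _.
    by apply: eqK_teq => f; rewrite !ev_left_wt gon_from_nil.
  rewrite /open_cut addn0 -eqn_leq; case: eqP => [sn|sn]; last first.
    apply: eqK_teq => f; rewrite ev_left_wt ev_tensp ev_nil [LHS]big_seq big1 // => e.
    have /allP HI := allsz_Iint p acc false; move=> /HI /eqP es;
    by rewrite ev_pword /= es; move/eqP/negbTE: sn => ->; rewrite mul0r !mulr0.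
  rewrite sn subnn cats0 /=.
  apply: eqK_trans (tensp (Iint p acc false) (pword [::])) _ _ _.
    apply: eqK_teq => f; rewrite ev_left_wt !ev_tensp; apply: eq_big_seq => e.
    have /allP HI := allsz_Iint p acc false; move=> /HI /eqP es;
    by rewrite !ev_pword /= es sn eqxx mul1r.
  apply: eqK_trans (tensp [:: (p%:R - false%:R, acc)] (pword [::])) _ _ _.
    by apply: eqK_tens; rewrite -?sn ?allsz_Iint ?allsz_word //; apply: Iint_mod.
  by apply: eqK_teq => f; rewrite ev_tensp !ev1 mul1r.
- apply: eqK_trans (open_cut p [:: x] w ++ consr x (cuts x w)) _ _ _.
    apply: eqK_trans (eqK_cat _ _ _ _ (IH2 p [:: x] isT) (eqK_mapr _ _ _ (IH1 x))).
    apply: eqK_teq => f; rewrite ev_cat ev_gon_from_cons; congr (_ + _).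
    rewrite (left_wt_lshuffle 0) ?Iint_nil //= subn0 ev_lshuffle1; congr (ev f (mapr _ _)).
  apply: eqK_teq => f; rewrite !ev_cat addrC; congr (_ + ev f _).
  by rewrite /open_cut /prefix_cut; case: n n0 => // k _; rewrite /= subSS subn0 add1n.
have Hc : eqK (left_wt n (gon_from p acc (x :: w))) (open_cut p (rcons acc x) w ++
    if (size acc <= n)%N then lshuffle (Iint p acc x) x (left_wt (n - size acc) (gon_from x [::] w))
    else [::]).
  apply: eqK_trans (eqK_cat _ _ _ _ (IH2 p (rcons acc x) _) (eqK_teq _ _ (fun=> erefl))).
    apply: eqK_teq => f; rewrite ev_cat ev_gon_from_cons; congr (_ + _).
    by rewrite (left_wt_lshuffle (size acc)) ?allsz_Iint.
  by rewrite size_rcons.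
apply: eqK_trans Hc _; rewrite /open_cut size_rcons.
(* If [acc] has length [n], the segment must close at [x]. If it is longer, nothing contributes. If
   it is shorter, keeping [x] leaves the missing weight to later segments, hence a product. *)
case: (ltngtP (size acc) n) => sn /=; last first.
- rewrite sn subnn leq_addr /=.
  apply: eqK_trans (tensp (Iint p acc x) (pword (x :: w))) _ _ _.
    apply: eqK_teq => f; rewrite ev_lshuffle left_wt0_gon_from ev1 mul1r ev_tensp; apply: eq_ev => u.
    by rewrite ev_pword sum_shws0.
  apply: eqK_trans (tensp [:: (p%:R - x%:R, acc)] (pword (x :: w))) _ _ _.
    by apply: eqK_tens; rewrite -?sn ?allsz_Iint ?allsz_word //; apply: Iint_mod.
  by apply: eqK_teq => f; rewrite ev_tensp !ev1 mul1r cats0.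
- exact: eqK_teq.
- rewrite addSnnS; have [k Ek] : exists k, (n - size acc = k.+1)%N.
    by exists (n - size acc).-1; rewrite prednK // subn_gt0.
  have -> : (n - (size acc).+1 = k)%N by rewrite subnS Ek.
  rewrite Ek /= cat_rcons -[X in eqK _ X]cats0.
  apply: eqK_cat; first exact: eqK_teq.
  apply/eqK_inK/inK_flatten => e; rewrite mem_filter => /andP[/eqP es _].
  apply: inK_tens; apply: kerLP.
    have -> : n = (size acc + k.+1)%N by rewrite -Ek subnKC // ltnW.
    by apply: allsz_shuffle; rewrite ?allsz_Iint ?allsz_word ?es.
  apply: inL_prod; first exact: allsz_posw s0 (allsz_Iint _ _ _).
  by apply: posw_word; rewrite es.
Qed.
End Cuts.

Lemma Dodd_mod r p : eqK (2 * r + 1) (Dodd r p) (cuts_lin (2 * r + 1) p).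
Proof.
set n := (2 * r + 1)%N.
apply: eqK_trans (flatten [seq tscale e.1 (left_wt n (gon_from true [::] e.2)) | e <- p]) _ _ _.
  apply: eqK_teq => f; rewrite (ev_filter _ f (fun x : word * word => size x.1 == n)).
  (* The subtracted term 1 (x) p has left weight 0, so the projection to weight 2r+1 removes it. *)
  rewrite ev_tsub ev_tensp ev_pword /= !ev_flatten /n addn1 [X in _ - X](_ : _ = 0); last first.
    by rewrite -[RHS](ev0 _ p); apply: eq_ev => w; rewrite mul0r.
  by rewrite subr0; apply: eq_bigr => e _; rewrite !ev_tscale ev_left_wt.
apply: eqK_flatten => e _; apply: eqK_scale.
by apply: (left_wt_gon_from n _ e.2).1; rewrite /n addn1.
Qed.

(** * The derivation property *)

Fixpoint splits (w : word) : seq (word * word) :=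
  ([::], w) :: if w is x :: w' then [seq (x :: e.1, e.2) | e <- splits w'] else [::].
Definition sum_splits (w : word) (g : word -> word -> rat) : rat :=
  \sum_(e <- splits w) g e.1 e.2.

Lemma sum_splits_nil g : sum_splits [::] g = g [::] [::].
Proof. exact: big_seq1. Qed.
Lemma sum_splits_cons x w g : sum_splits (x :: w) g = g [::] (x :: w) + sum_splits w (fun p => g (x :: p)).
Proof. by rewrite /sum_splits big_cons big_map. Qed.
Lemma eq_sum_splits w g h : (forall p q, g p q = h p q) -> sum_splits w g = sum_splits w h.
Proof. by move=> H; apply: eq_bigr => e _. Qed.
Lemma sum_splitsD w g h : sum_splits w (fun p q => g p q + h p q) = sum_splits w g + sum_splits w h.
Proof. exact: big_split. Qed.
Lemma sum_splitsZ w c g : sum_splits w (fun p q => c * g p q) = c * sum_splits w g.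
Proof. by rewrite /sum_splits big_distrr. Qed.
Lemma sum_splits_head w g : sum_splits w (fun p q => (size p == 0)%:R * g p q) = g [::] w.
Proof.
case: w => [|x w]; first by rewrite sum_splits_nil mul1r.
by rewrite sum_splits_cons mul1r sum_splitsZ mul0r addr0.
Qed.

(** Deconcatenation is a homomorphism for the shuffle product; the induction on first letters treats
    the empty prefix separately. *)
Lemma sum_shw_sum_splits u v g : sum_shw u v (fun w => sum_splits w g) =
  sum_splits u (fun u1 u2 => sum_splits v (fun v1 v2 => sum_shw u1 v1 (fun p => sum_shw u2 v2 (g p)))).
Proof.
elim: u v g => [|x u IHu] v g.
  by rewrite sum_shw0s sum_splits_nil; apply: eq_sum_splits => p q; rewrite !sum_shw0s.
elim: v g => [|y v IHv] g.
  by rewrite sum_shws0; apply: eq_sum_splits => p q; rewrite sum_splits_nil !sum_shws0.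
have E1 : sum_shw u (y :: v) (fun w => sum_splits (x :: w) g) =
    sum_shw u (y :: v) (fun w => g [::] (x :: w)) + sum_shw u (y :: v) (fun w => sum_splits w (fun p => g (x :: p))).
  by rewrite -sum_shwD; apply: eq_sum_shw => w; rewrite sum_splits_cons.
have E2 : sum_shw (x :: u) v (fun w => sum_splits (y :: w) g) =
    sum_shw (x :: u) v (fun w => g [::] (y :: w)) + sum_shw (x :: u) v (fun w => sum_splits w (fun p => g (y :: p))).
  by rewrite -sum_shwD; apply: eq_sum_shw => w; rewrite sum_splits_cons.
rewrite sum_shw_cons E1 E2 IHu IHv !sum_splits_cons !sum_shw0s sum_shw_cons.
have -> : sum_splits u (fun u1 u2 => sum_splits (y :: v)
      (fun v1 v2 => sum_shw u1 v1 (fun p => sum_shw u2 v2 (g (x :: p))))) =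
    sum_splits u (fun u1 u2 => sum_shw u2 (y :: v) (g (x :: u1))) +
    sum_splits u (fun u1 u2 => sum_splits v (fun v1 v2 => sum_shw u1 (y :: v1) (fun p => sum_shw u2 v2 (g (x :: p))))).
  by rewrite -sum_splitsD; apply: eq_sum_splits => p q; rewrite sum_splits_cons sum_shws0.
have -> : sum_splits u (fun u1 u2 => sum_splits (y :: v)
      (fun v1 v2 => sum_shw (x :: u1) v1 (fun p => sum_shw u2 v2 (g p)))) =
    sum_splits u (fun u1 u2 => sum_shw u2 (y :: v) (g (x :: u1))) +
    (sum_splits u (fun u1 u2 => sum_splits v (fun v1 v2 => sum_shw u1 (y :: v1) (fun p => sum_shw u2 v2 (g (x :: p))))) +
     sum_splits u (fun u1 u2 => sum_splits v (fun v1 v2 => sum_shw (x :: u1) v1 (fun p => sum_shw u2 v2 (g (y :: p)))))).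
  rewrite -!sum_splitsD; apply: eq_sum_splits => p q; rewrite sum_splits_cons sum_shws0; congr (_ + _).
  by rewrite -sum_splitsD; apply: eq_sum_splits => p' q'; rewrite sum_shw_cons.
have -> : sum_splits v (fun p q => sum_shw [::] p (fun p0 => sum_shw (x :: u) q (g (y :: p0)))) =
          sum_splits v (fun p q => sum_shw [::] (y :: p) (fun p0 => sum_shw (x :: u) q (g p0))).
  by apply: eq_sum_splits => p q; rewrite !sum_shw0s.
by ring.
Qed.

Lemma prefix_cut_sum_splits f n c w : ev f (prefix_cut n c w) =
  sum_splits w (fun p q => (size p == n)%:R * ((c%:R - (head false q)%:R) * f (p, q))).
Proof.
rewrite /prefix_cut; elim: w n f => [|x w IH] [|n] f.
- by rewrite sum_splits_nil ev1 /= mul1r.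
- by rewrite sum_splits_nil ev_nil mul0r.
- rewrite sum_splits_cons ev1 /= mul1r -[LHS]addr0; congr (_ + _).
  by rewrite /sum_splits big1 // => e _; rewrite mul0r.
rewrite sum_splits_cons mul0r add0r; move: (IH n (fun e => f (x :: e.1, e.2))) => /= <-.
by rewrite ltnS; case: leqP => _; rewrite ?ev_nil // !ev1.
Qed.

(** The cuts of the shuffles of [u] and [v] whose removed prefix comes from [u] alone. The
    coefficient sees the first letter of the shuffled remainder, which may belong to [v]. *)
Definition prefix_shuffle (n : nat) (c : bool) (u v : word) : nctens :=
  flatten [seq if size e.1 == n then
      [seq (c%:R - (head false q)%:R, (e.1, q)) | q <- shw e.2 v] else [::] | e <- splits u].

Lemma ev_prefix_shuffle f n c u v : ev f (prefix_shuffle n c u v) =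
  sum_splits u (fun p q => (size p == n)%:R *
    sum_shw q v (fun w => (c%:R - (head false w)%:R) * f (p, w))).
Proof.
rewrite ev_flatten; apply: eq_bigr => e _.
by case: eqP => _; rewrite ?ev_nil ?mul0r // mul1r /ev big_map.
Qed.

(** The first letter of the shuffled word is either the head h of [u] or [y]; in the latter case c -
    y = (c - h) - (y - h). *)
Lemma sum_shw_head u y v c f :
  sum_shw u (y :: v) (fun w => (c%:R - (head false w)%:R) * f w) =
  (c%:R - (head false u)%:R) * sum_shw u (y :: v) f
  - (y%:R - (head false u)%:R) * sum_shw u v (fun w => f (y :: w)).
Proof.
case: u => [|z u]; first by rewrite !sum_shw0s /=; ring.
by rewrite !sum_shw_cons /= !sum_shwZ; ring.
Qed.

Lemma ev_prefix_shuffle_cons f n c u y v : ev f (prefix_shuffle n c u (y :: v)) =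
  ev (fun e => sum_shw e.2 (y :: v) (fun w => f (e.1, w))) (prefix_cut n c u) -
  ev (fun e => sum_shw e.2 v (fun w => f (e.1, y :: w))) (prefix_cut n y u).
Proof.
rewrite ev_prefix_shuffle !prefix_cut_sum_splits -mulN1r -sum_splitsZ -sum_splitsD; apply: eq_sum_splits => p q.
by rewrite sum_shw_head /=; ring.
Qed.

Lemma ev_tsub_cat f t u v : ev f (tsub t (u ++ v)) = ev f t - (ev f u + ev f v).
Proof. by rewrite ev_tsub ev_cat. Qed.

Section Derivation.
Variables (n : nat) (n0 : (0 < n)%N).

(* A prefix of length [n] of a shuffle is a shuffle of prefixes, so it is a
   product unless it comes entirely from one of the two words. *)
Lemma prefix_cut_shuffle c u v :
  eqK n (flatten [seq prefix_cut n c w | w <- shw u v]) (prefix_shuffle n c u v ++ prefix_shuffle n c v u).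
Proof.
pose mixed (e e' : word * word) := [&& (0 < size e.1)%N, (0 < size e'.1)%N &
  (size e.1 + size e'.1 == n)%N].
pose M := flatten [seq flatten [seq if mixed e e' then
  tensp (shuffle (pword e.1) (pword e'.1))
    [seq (c%:R - (head false q)%:R, q) | q <- shw e.2 e'.2] else [::]
  | e' <- splits v] | e <- splits u].
have KM : inK n M.
  apply: inK_flatten => e _; apply: inK_flatten => e' _.
  rewrite /mixed; case: and3P => [[H1 H2 /eqP <-]|_]; last exact: inK_nil.
  apply: inK_tens; apply: kerLP; first by apply: allsz_shuffle; rewrite allsz_word.
  by apply: inL_prod; apply: posw_word.
apply: inK_eq KM => f.
pose k p q := (c%:R - (head false q)%:R) * f (p, q).
have EP : ev f (flatten [seq prefix_cut n c w | w <- shw u v]) =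
    sum_shw u v (fun w => sum_splits w (fun p q => (size p == n)%:R * k p q)).
  by rewrite ev_flatten; apply: eq_bigr => w _; rewrite prefix_cut_sum_splits.
pose g u1 u2 v1 v2 := ev f (if mixed (u1, u2) (v1, v2) then
  tensp (shuffle (pword u1) (pword v1))
    [seq (c%:R - (head false q)%:R, q) | q <- shw u2 v2] else [::]).
(* As [n] is positive, the prefixes [u1] and [v1] of a cut are not both empty: either both are
   nonempty, which gives [g], or one of them is the whole cut. *)
have E u1 u2 v1 v2 :
    sum_shw u1 v1 (fun p => sum_shw u2 v2 (fun q => (size p == n)%:R * k p q)) = g u1 u2 v1 v2 +
    ((size v1 == 0)%:R * ((size u1 == n)%:R * sum_shw u2 v2 (k u1)) +
     (size u1 == 0)%:R * ((size v1 == n)%:R * sum_shw v2 u2 (k v1))).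
  have -> : sum_shw u1 v1 (fun p => sum_shw u2 v2 (fun q => (size p == n)%:R * k p q)) =
      (size u1 + size v1 == n)%N%:R * sum_shw u1 v1 (fun p => sum_shw u2 v2 (k p)).
    by rewrite -sum_shwZ; apply: eq_big_seq => p /size_shw ->; rewrite sum_shwZ.
  rewrite /g /mixed /=.
  case: u1 => [|x u1].
    rewrite sum_shw0s ev_nil sum_shwC /= add0n mul1r add0r (ltn_eqF n0).
    by rewrite mul0r mulr0 add0r.
  case: v1 => [|y v1]; first by rewrite sum_shws0 ev_nil addn0 /= mul1r mul0r addr0 add0r.
  rewrite /= !mul0r !addr0; case: eqP => _; rewrite ?ev_nil ?mul0r // mul1r.
  rewrite ev_tensp ev_shuffle !ev_pword; apply: eq_sum_shw => p.
  by rewrite [RHS]/ev big_map.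
rewrite ev_tsub ev_cat EP sum_shw_sum_splits; under eq_sum_splits do under eq_sum_splits do rewrite E.
under eq_sum_splits do rewrite !sum_splitsD sum_splits_head sum_splitsZ.
rewrite !sum_splitsD sum_splits_head !ev_prefix_shuffle.
apply: etrans (esym (addrK _ _)); rewrite ev_flatten.
by apply: eq_bigr => -[u1 u2] _; rewrite ev_flatten; apply: eq_bigr => -[].
Qed.

Lemma cuts_cons f c x w :
  ev f (cuts n c (x :: w)) = ev (fun e => f (e.1, x :: e.2)) (cuts n x w) + ev f (prefix_cut n c (x :: w)).
Proof. by rewrite ev_cat ev_consr. Qed.

(** Induction on the first letters. The induction hypothesis produces cuts of a prefix of one word
    placed after the first letter of the other, with the wrong left neighbour; they cancel against
    the negative terms of [ev_prefix_shuffle_cons]. *)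
Lemma cuts_shuffle c u v :
  eqK n (flatten [seq cuts n c w | w <- shw u v]) (shr v (cuts n c u) ++ shr u (cuts n c v)).
Proof.
have evD0 f (u' v' : word) c' : ev f (flatten [seq cuts n c' w | w <- shw u' v']) =
  sum_shw u' v' (fun w => ev f (cuts n c' w)) by rewrite ev_flatten.
elim: u v c => [|x u IHu] v c.
  apply: eqK_teq => f; rewrite evD0 sum_shw0s ev_cat !ev_shr ev_nil add0r.
  by apply: eq_ev => -[p q]; rewrite sum_shws0.
elim: v c => [|y v IHv] c.
  apply: eqK_teq => f; rewrite evD0 sum_shws0 ev_cat !ev_shr ev_nil addr0.
  by apply: eq_ev => -[p q]; rewrite sum_shws0.
have K := inK_cat _ _ _ (inK_mapr _ (fun w => pword (x :: w)) _ (IHu (y :: v) x))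
         (inK_cat _ _ _ (inK_mapr _ (fun w => pword (y :: w)) _ (IHv y)) (prefix_cut_shuffle c (x :: u) (y :: v))).
apply: inK_eq K => f.
rewrite ev_cat ev_cat -!/(consr _ _) !ev_consr !ev_tsub_cat !ev_prefix_shuffle_cons !evD0 !ev_shr.
rewrite !sum_shw_cons.
have EP : ev f (flatten [seq prefix_cut n c w | w <- shw (x :: u) (y :: v)]) =
  sum_shw u (y :: v) (fun w => ev f (prefix_cut n c (x :: w))) + sum_shw (x :: u) v (fun w => ev f (prefix_cut n c (y :: w))).
  by rewrite ev_flatten -(sum_shw_cons x u y v (fun w => ev f (prefix_cut n c w))).
rewrite EP.
have -> : sum_shw u (y :: v) (fun w => ev f (cuts n c (x :: w))) =
    sum_shw u (y :: v) (fun w => ev (fun e => f (e.1, x :: e.2)) (cuts n x w)) +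
    sum_shw u (y :: v) (fun w => ev f (prefix_cut n c (x :: w))).
  by rewrite -sum_shwD; apply: eq_sum_shw => w; rewrite cuts_cons.
have -> : sum_shw (x :: u) v (fun w => ev f (cuts n c (y :: w))) =
    sum_shw (x :: u) v (fun w => ev (fun e => f (e.1, y :: e.2)) (cuts n y w)) +
    sum_shw (x :: u) v (fun w => ev f (prefix_cut n c (y :: w))).
  by rewrite -sum_shwD; apply: eq_sum_shw => w; rewrite cuts_cons.
rewrite !cuts_cons /=.
under [X in _ = _ - (X + _ + _)]eq_ev do rewrite sum_shw_cons.
under [X in _ = _ - (_ + (X + _))]eq_ev do rewrite sum_shw_cons.
by rewrite !evD; ring.
Qed.
End Derivation.

(** * Words in the blocks x0 x1 and x0 x0 x1 *)

(* [w] completes a concatenation of blocks x0 x1 and x0 x0 x1, when the last letter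
   read is p; for p = x0, r tells whether the letter before it was x0 too. *)
Fixpoint blocks23 (p r : bool) (w : word) : bool :=
  if w is x :: w' then
    if x then ~~ p && blocks23 true false w' else (p || ~~ r) && blocks23 false (~~ p) w'
  else p.

(** Adjacent equal letters in [p :: w]. In a word of blocks these are the pairs x0 x0, one for each
    index 3. *)
Fixpoint reps (p : bool) (w : word) : nat :=
  if w is x :: w' then ((p == x) + reps x w')%N else 0%N.

Definition idx23 (k : seq nat) := all (fun i => (i == 2%N) || (i == 3%N)) k.

Lemma iw_cat k k' : iw (k ++ k') = iw k ++ iw k'.
Proof. by rewrite /iw map_cat flatten_cat. Qed.

Lemma blocks23_iw k r : idx23 k -> [/\ blocks23 true r (iw k),
  reps true (iw k) = count_mem 3%N k & size (iw k) = sumn k].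
Proof.
elim: k r => [|i k IH] r //= /andP[/orP[] /eqP -> /(IH false) [A R S]];
  by rewrite /= ?A R -?S.
Qed.

Lemma blocks23_index r w : blocks23 true r w -> exists k, [/\ idx23 k, iw k = w,
  count_mem 3%N k = reps true w & sumn k = size w].
Proof.
have [m] := ubnP (size w); elim: m r w => // m IH r [|[] [|[] w]] //=; first by exists [::].
  move=> sz /(IH false)[|k [A W R S]]; first by lia.
  by exists (2%N :: k); split => //; rewrite /= ?S // -W.
case: w => [|[] w] //= sz /(IH false)[|k [A W R S]]; first by lia.
by exists (3%N :: k); split => //=; rewrite ?S ?R // -W.
Qed.

Lemma blocks23_cat p r s w : blocks23 p r (s ++ w) -> exists r', blocks23 (last p s) r' w.
Proof.
elim: s p r => [|x s IH] p r /=; first by exists r.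
by case: x => /andP[_ /IH].
Qed.

Lemma blocks23_weaken r w : blocks23 false r w -> blocks23 false false w.
Proof. by case: w => [|[] w] //= /andP[_]. Qed.

Lemma reps_cat p s w : reps p (s ++ w) = (reps p s + reps (last p s) w)%N.
Proof. by elim: s p => [|x s IH] p //=; rewrite IH addnA. Qed.

(** The remaining adjacent pairs are changes of letter, and the parity of their number tells whether
    [p] and the last letter differ. *)
Lemma odd_reps p s : odd (reps p s) = odd (size s) (+) p (+) last p s.
Proof. by elim: s p => [|x s IH] p /=; rewrite ?addbb // oddD IH; case: (odd _) p x (last _ _) => [] [] [] []. Qed.

Fixpoint no11 (p : bool) (w : word) : bool :=
  if w is x :: w' then ~~ (p && x) && no11 x w' else true.

Lemma blocks23_no11 p r s w : blocks23 p r (s ++ w) -> no11 p (rcons s (head false w)).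
Proof.
elim: s p r => [|x s IH] p r.
  by case: w => [|[] w] //=; rewrite ?andbF //= => /andP[/negbTE ->].
case: x => /= /andP[H /IH ->]; rewrite ?andbF // andbT.
by case: p H.
Qed.

(** Since [p] differs from the letter after the cut, deleting [s] creates no repetition at the
    junction, and those lost lie between [p] and that letter. *)
Lemma blocks23_cut p r s w : blocks23 p r (s ++ w) -> p != head false w ->
  blocks23 p r w /\ (reps p w + reps p (rcons s (head false w)) = reps p (s ++ w))%N.
Proof.
move=> /[dup] /blocks23_cat[r' A'] A; rewrite reps_cat -cats1 reps_cat.
(* When [w] is empty, [s] ends in x1 or is empty with p = x1, so the final x0 supplied by [head]
   adds no repetition. *)
case: w A A' => [|x w] /= A A' px; first by case: p {A} px A' => // _ ->.
rewrite (negbTE px) add0n addn0; split; last by lia.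
case: p {A} x px A' => [] [] //= _; first by case/andP=> _; apply: blocks23_weaken.
by case/andP.
Qed.

(** * Alternating words and words with one pair x0 x0 *)

Fixpoint alt (p : bool) (n : nat) : word :=
  if n is n'.+1 then p :: alt (~~ p) n' else [::].

Lemma size_alt p n : size (alt p n) = n.
Proof. by elim: n p => //= n IH p; rewrite IH. Qed.

Lemma alt_rcons p n : alt p n.+1 = rcons (alt p n) (p (+) odd n).
Proof.
elim: n p => [|n IH] p; first by rewrite /= addbF.
by rewrite [LHS]/= -/(alt _ n.+1) IH /= addbN addNb.
Qed.

Lemma rev_alt p n : rev (alt p n.+1) = alt (p (+) odd n) n.+1.
Proof.
elim: n p => [|n IH] p; first by rewrite addbF.
by rewrite alt_rcons rev_rcons IH [RHS]/= -/(alt _ n.+1) addbN negbK.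
Qed.

Lemma alt_even a : alt false a.*2 = iw (nseq a 2%N).
Proof. by elim: a => //= a ->. Qed.

Lemma alt_one3 a c : alt false a.*2.+1 ++ alt false c.*2.+2 =
  iw (nseq a 2%N ++ 3%N :: nseq c 2%N).
Proof. by rewrite alt_rcons odd_double iw_cat cat_rcons /= !alt_even. Qed.

Lemma reps0_alt p s : reps p s = 0%N -> s = alt (~~ p) (size s).
Proof. by elim: s p => //= x s IH p; case: p x => [] [] //= /IH ->; rewrite size_alt. Qed.

(** With x1 x1 excluded the single repetition is a pair x0 x0, and letters alternate on both sides
    of it. The parity of [i] says that the letter before the second x0 of the pair is x0. *)
Lemma reps1_alt p s : no11 p s -> reps p s = 1%N ->
  exists i j, s = alt (~~ p) i ++ false :: alt true j /\ odd i = p.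
Proof.
elim: s p => //= x s IH p /andP[H1 /IH H2].
case: (eqVneq p x) H1 => [->|px] /= H1.
  case: x {H2} H1 => // _ [] /reps0_alt Es.
  by exists 0%N, (size s); rewrite /= -Es.
rewrite add0n => /H2 [i [j [-> E]]]; exists i.+1, j; rewrite /= negbK E.
by case: p x px {H1 H2 E} => [] [].
Qed.

(** In the first shape the pair x0 x0 is formed with a neighbour of the cut; in the other two it
    lies inside [s]. The second shape is a word (2,..,2,3,2,..,2), the third the reversal of one. *)
Definition one00 (s : word) : Prop :=
  [\/ exists a, s = alt false a.*2.+1,
      exists a c, s = alt false a.*2.+1 ++ alt false c.*2.+2 |
      exists a c, s = alt true a.*2.+2 ++ alt false c.*2.+1].

Lemma reps1_one00 p s b : p != b -> odd (size s) -> no11 p (rcons s b) ->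
  reps p (rcons s b) = 1%N -> one00 s.
Proof.
move=> pb os /reps1_alt /[apply] -[i [j [E oi]]].
have sz : (size s).+1 = (i + j.+1)%N.
  by rewrite -(size_rcons s b) E size_cat /= !size_alt.
have oj : odd j = ~~ p by move: os oi sz; lia.
case: j oj sz E => [|j] oj sz E.
  move: E; rewrite cats1 => /rcons_inj [-> _]; case: p oj oi pb => // _ oi _.
  by constructor 1; exists i./2; rewrite -[in LHS](odd_double_half i) oi.
move: E; rewrite alt_rcons -rcons_cons -rcons_cat => /rcons_inj [-> _].
have {}oj : odd j = p by exact: negb_inj oj.
rewrite -[false :: _]/(alt false j.+1) -(odd_double_half j) -(odd_double_half i) oi oj.
case: p {pb oi oj sz}; first by constructor 2; exists i./2, j./2.
case: (i./2) => [|a]; first by constructor 1; exists j./2.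
by constructor 3; exists a, j./2.
Qed.

Lemma mem_consr x t e : e \in consr x t ->
  exists2 e', e' \in t & e = (e'.1, (e'.2.1, x :: e'.2.2)).
Proof.
move=> /flattenP[s /mapP[e' He' ->]] /=; rewrite inE => /eqP ->.
by exists e'; rewrite ?mulr1.
Qed.

(** A nonzero coefficient needs different letters around the cut; by [odd_reps] and the oddness of
    [n], the number of repetitions removed is then odd, so one or at least three. *)
Lemma cuts_entry n p r w e : odd n -> blocks23 p r w -> e \in cuts n p w -> e.1 = 0 \/
  [/\ size e.2.1 = n, (size e.2.2 + n = size w)%N, blocks23 p r e.2.2 &
      (reps p e.2.2 + 1 = reps p w)%N /\ one00 e.2.1 \/ (reps p e.2.2 + 3 <= reps p w)%N].
Proof.
move=> on; elim: w p r e => [//|x w IH] p r e A; rewrite mem_cat => /orP[|].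
  have A' : blocks23 x (~~ x && ~~ p) w by case: x A {IH} => /= /andP[].
  move=> /mem_consr[e' He' ->] /=.
  case: (IH _ _ _ A' He') => [E|[H1 H2 H3 H4]]; [by left|right; split=> //].
  - by rewrite addSn H2.
  - by clear He'; case: x A A' H3 {H1 H2 H4 IH} => /= /andP[-> _] _ ->.
  - by case: H4 => [[H4 H5]|H4]; [left; split => //|right]; rewrite -addnA ?H4 ?leq_add2l.
rewrite /prefix_cut; case: leqP => // nw; rewrite inE => /eqP -> /=.
set s := take n (x :: w); set v := drop n (x :: w).
have Ew : x :: w = s ++ v by rewrite cat_take_drop.
have sn : size s = n by rewrite size_takel.
have [->|pv] := eqVneq p (head false v); first by left; rewrite subrr.
rewrite -/(blocks23 p r (x :: w)) -/(reps p (x :: w)) Ew in A *.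
right; have [A' R] := blocks23_cut _ _ _ _ A pv; split=> //.
  by rewrite /v size_drop subnK.
have := odd_reps p (rcons s (head false v)).
rewrite size_rcons last_rcons sn /= on /= -R => o.
have {}o : odd (reps p (rcons s (head false v))) by rewrite o; move: pv; clear; case: p (head _ _) => [] [].
case E: (reps _ _) o => [|[|[|k]]] // _; last by right; lia.
left; split=> //; apply: reps1_one00 E => //; first by rewrite sn.
exact: blocks23_no11 A.
Qed.

Definition zeta_line (n : nat) (p : ncpoly) : Prop :=
  exists c, inL (psub p (pscale c (zeta_lift n))).

Lemma zeta_line_mod n p q : inL (psub p q) -> zeta_line n q -> zeta_line n p.
Proof. by move=> H [c Hc]; exists c; apply: inL_trans H Hc. Qed.
Lemma zeta_line_eq n p q : teq p q -> zeta_line n p -> zeta_line n q.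
Proof. by move=> H [c Hc]; exists c; apply: ideal_eq Hc => f; rewrite !ev_psub H. Qed.
Lemma zeta_line_inL n p : inL p -> zeta_line n p.
Proof. by move=> H; exists 0; apply: ideal_eq H => f; rewrite ev_psub ev_pscale; ring. Qed.
Lemma zeta_line_cat n p q : zeta_line n p -> zeta_line n q -> zeta_line n (p ++ q).
Proof.
move=> [c Hc] [d Hd]; exists (c + d); apply: ideal_eq (ideal_cat _ _ _ Hc Hd) => f.
by rewrite ev_cat !ev_psub ev_cat !ev_pscale; ring.
Qed.
Lemma zeta_line_scale n a p : zeta_line n p -> zeta_line n (pscale a p).
Proof.
move=> [c Hc]; exists (a * c); apply: ideal_eq (ideal_scale _ a _ Hc) => f.
by rewrite ev_pscale !ev_psub !ev_pscale; ring.
Qed.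
Lemma zeta_line_flatten n (B : eqType) (F : B -> ncpoly) (s : seq B) :
  (forall x, x \in s -> zeta_line n (F x)) -> zeta_line n (flatten [seq F x | x <- s]).
Proof.
elim: s => [|x s IH] H /=; first exact/zeta_line_inL/ideal_nil.
apply: zeta_line_cat; first by apply: H; rewrite mem_head.
by apply: IH => y Hy; apply: H; rewrite inE Hy orbT.
Qed.

(* Both insertions of x0 next to a given x0 of (x0 x1)^r give the same word. *)
Lemma sum_shw_x0_alt r f : sum_shw [:: false] (alt false r.*2) f = f (alt false r.*2.+1) +
  2%:R * \sum_(0 <= i < r) f (alt false i.*2 ++ false :: alt false (r - i).*2).
Proof.
elim: r f => [|r IH] f; first by rewrite sum_shws0 big_nil mulr0 addr0.
rewrite doubleS [alt false r.*2.+2]/= !sum_shw_cons !sum_shw0s /= IH big_nat_recl // subn0 doubleS /=.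
by rewrite -!/(alt false _); ring.
Qed.

Lemma one00_zeta_line r s : (0 < r)%N -> size s = (2 * r + 1)%N -> one00 s ->
  (forall a c, (a + c + 1)%N = r ->
     zeta_line (2 * r + 1) (pword (iw (nseq a 2%N ++ 3%N :: nseq c 2%N)))) ->
  zeta_line (2 * r + 1) (pword s).
Proof.
move=> r0 sz H Z; case: H sz => [[a ->]|[a [c ->]]|[a [c ->]]]; rewrite ?size_cat !size_alt => sz.
- have -> : a = r by lia.
  (* The product of x0 and (x0 x1)^r expands as the alternating word plus twice a sum of words
     (2,..,2,3,2,..,2). *)
  have H1 : inL (shuffle (pword [:: false]) (pword (alt false r.*2))).
    by apply: inL_prod; apply: posw_word; rewrite ?size_alt ?double_gt0.
  have H2 : zeta_line (2 * r + 1) (flatten [seq pword (alt false i.*2 ++ false :: alt false (r - i).*2)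
      | i <- index_iota 0 r]).
    apply: zeta_line_flatten => i; rewrite mem_index_iota => /andP[_ ir].
    have -> : (r - i = (r - i.+1).+1)%N by lia.
    have Ea : rcons (alt false i.*2) false = alt false i.*2.+1 by rewrite alt_rcons odd_double.
    by rewrite -cat_rcons Ea doubleS alt_one3; apply: Z; lia.
  apply: zeta_line_eq (zeta_line_cat _ _ _ (zeta_line_inL _ _ H1) (zeta_line_scale _ (- 2%:R) _ H2)) => f.
  rewrite ev_cat ev_pscale ev_shuffle !ev_pword sum_shw_x0_alt ev_flatten.
  under [\sum_(_ <- index_iota 0 r) ev _ _]eq_bigr do rewrite ev_pword.
  by ring.
- by rewrite alt_one3; apply: Z; lia.
(* In odd weight the antipode relation says that a word equals its reversal modulo products, which
   turns the third shape into the second. *)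
set z := _ ++ _.
have ss : size z = (2 * r + 1)%N by rewrite size_cat !size_alt.
have Er : rev z = iw (nseq c 2%N ++ 3%N :: nseq a 2%N).
  by rewrite rev_cat !rev_alt /= !odd_double /= -/(alt _ _) -alt_one3.
apply: (zeta_line_mod _ _ (pword (rev z))); last by rewrite Er; apply: Z; lia.
have s0 : (0 < size z)%N by rewrite ss addn1.
apply: ideal_eq (rev_mod z s0) => f.
rewrite !ev_psub !ev_pword !ev1 ss -signr_odd addn1 mul2n /= odd_double; ring.
Qed.

(** * Proportionality to odd zeta values *)

Lemma ev_iota_lin f s : ev f (iota_lin s) = ev (fun k => f (iw k)) s.
Proof. by rewrite /ev big_map. Qed.

Lemma ev_cuts_lin n f p : ev f (cuts_lin n p) = ev (fun w => ev f (cuts n true w)) p.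
Proof. by rewrite ev_flatten; apply: eq_bigr => e _; rewrite ev_tscale. Qed.

Definition one3_zeta (r : nat) : Prop := forall a c, (a + c + 1)%N = r ->
  zeta_line (2 * r + 1) (pword (iw (nseq a 2%N ++ 3%N :: nseq c 2%N))).

Lemma ev_cut_form f n e t : ev f (tensp (zeta_lift n) (iota_lin e) ++ t) =
  ev (fun k => f (iw [:: n], iw k)) e + ev f t.
Proof. by rewrite ev_cat ev_tensp ev_pword ev_iota_lin. Qed.

Lemma allsz_flatten n (B : eqType) (F : B -> ncpoly) (s : seq B) :
  (forall x, x \in s -> allsz n (F x)) -> allsz n (flatten [seq F x | x <- s]).
Proof.
elim: s => [//|x s IH] H; rewrite /= allsz_cat H ?mem_head //=.
by apply: IH => y Hy; apply: H; rewrite inE Hy orbT.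
Qed.

(** * The shape of D_(2r+1) on words in the indices 2 and 3 *)

Section Conclusion.
Variables (r l N : nat).
Notation n := (2 * r + 1)%N.

(** The shape claimed in the second assertion, required modulo [inK], which is finer than [Kn]. Here
    [N] is the weight of the right-hand factor. *)
Definition cut_form (t : nctens) : Prop :=
  exists (e : ncipoly) (s : seq (ncpoly * seq nat)),
  [/\ forall x, x \in e -> Fidx (l%:Z - 1) x.2 && (sumn x.2 == N),
      LtensF_ok n (l%:Z - 2) s &
      eqK n t (tensp (zeta_lift n) (iota_lin e) ++ LtensF n (l%:Z - 2) s)].

Lemma cut_form_eqK t u : eqK n t u -> cut_form u -> cut_form t.
Proof. by move=> H [e [s [He Hs K]]]; exists e, s; split=> //; apply: eqK_trans H K. Qed.

Lemma cut_form_inK t : inK n t -> cut_form t.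
Proof.
move=> H; exists [::], [::]; split=> //.
by apply: eqK_trans (eqK_inK _ _ H) (eqK_teq _ _ _ _).
Qed.

Lemma cut_form_cat t u : cut_form t -> cut_form u -> cut_form (t ++ u).
Proof.
move=> [e [s [He Hs K]]] [e' [s' [He' Hs' K']]]; exists (e ++ e'), (s ++ s'); split.
- by move=> x; rewrite mem_cat => /orP[/He|/He'].
- by move=> x; rewrite mem_cat => /orP[/Hs|/Hs'].
apply: eqK_trans (eqK_cat _ _ _ _ _ K K') (eqK_teq _ _ _ _) => f.
rewrite ev_cat !ev_cut_form ev_cat /LtensF !ev_tsum map_cat big_cat /=.
by ring.
Qed.

Lemma cut_form_seq t : (forall e, e \in t -> cut_form [:: e]) -> cut_form t.
Proof.
elim: t => [|e t IH] H; first exact/cut_form_inK/inK_nil.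
rewrite -cat1s; apply: cut_form_cat; first by apply: H; rewrite mem_head.
by apply: IH => y Hy; apply: H; rewrite inE Hy orbT.
Qed.

Lemma cut_form_cuts (r0 : (0 < r)%N) (Z : one3_zeta r) c k :
  Fidx l%:Z k -> sumn k = (N + n)%N -> cut_form (tscale c (cuts n true (iw k))).
Proof.
move=> /andP[k23 kl] sk; apply: cut_form_seq => _ /mapP[[c' [s q]] He ->] /=.
have [A R S] := blocks23_iw k false k23.
have on : odd n by lia.
case: (cuts_entry _ _ _ _ _ on A He) => /= [->|[ss sq /blocks23_index [k' [k'23 Eq R' S']]]].
  by apply: cut_form_inK; apply: inK_eq (inK_nil _) => f; rewrite ev1 ev_nil mulr0 mul0r.
have sk' : sumn k' == N by rewrite S' -(eqn_add2r (2 * r + 1)) sq S sk.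
rewrite -R' -Eq R; case=> [[Rk /(one00_zeta_line _ _ r0 ss)/(_ Z) [d Hd]]|Rk].
  (* [c] is the coefficient of the word, [c'] that of the cut, and [d] the ratio of [s] to
     zeta(2r+1). *)
  exists [:: (c * c' * d, k')], [::]; split=> // [x|].
    rewrite inE => /eqP -> /=; rewrite sk' andbT /Fidx -/(idx23 _) k'23 /=.
    by move: kl; rewrite -Rk lerBrDr PoszD.
  apply: eqK_trans (tensp (pscale (c * c' * d) (zeta_lift n)) (pword (iw k'))) _ _ _; last first.
    by apply: eqK_teq => f; rewrite ev_cat !ev_tensp ev_pscale !ev_pword ev1 ev_nil addr0.
  apply: eqK_trans (tensp (pscale (c * c') (pword s)) (pword (iw k'))) _ _ _.
    by apply: eqK_teq => f; rewrite ev_tensp ev_pscale !ev_pword ev1.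
  apply: eqK_tens; rewrite ?allsz_scale ?allsz_word ?ss //.
    by rewrite /iw /= cats0 size_rcons size_nseq; lia.
  apply: ideal_eq (ideal_scale _ (c * c') _ Hd) => f.
  by rewrite ev_pscale !ev_psub !ev_pscale; ring.
(* At least three indices 3 are lost, so the right factor lies even in F_(l-3). *)
exists [::], [:: ([:: (c * c', s)], k')]; split=> // [x|].
  rewrite inE => /eqP -> /=; split; first by apply: allsz_homog; rewrite allsz_word ss.
  rewrite /Fidx -/(idx23 _) k'23 /= lerBrDr -PoszD; apply: le_trans kl; rewrite lez_nat.
  by apply: leq_trans Rk; rewrite leq_add2l.
apply: eqK_teq => f.
by rewrite ev_cut_form ev_nil add0r ev_tsum big_seq1 ev_tensp !ev1 mul1r.
Qed.
End Conclusion.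

(** * Cuts of zeta(m), of zeta(2,..,2), and of words with a single index 3 *)

Lemma sum_shw_x0_x0 k f : sum_shw [:: false] (nseq k false) f = k.+1%:R * f (nseq k.+1 false).
Proof.
elim: k f => [|k IH] f; first by rewrite sum_shws0 mul1r.
by rewrite [nseq k.+1 _]/= sum_shw_cons sum_shw0s IH /= [k.+2%:R]mulrS; ring.
Qed.

Lemma inL_x0 k c : (1 < k)%N -> inL [:: (c, nseq k false)].
Proof.
case: k => // k k0.
have H : inL (shuffle (pword [:: false]) (pword (nseq k false))).
  by apply: inL_prod; apply: posw_word; rewrite ?size_nseq.
apply: ideal_eq (ideal_scale _ (c / k.+1%:R) _ H) => f.
rewrite ev_pscale ev_shuffle !ev_pword ev1 sum_shw_x0_x0 mulrA divfK //.
by rewrite pnatr_eq0.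
Qed.

Section DepthOne.
Variables (n : nat) (n2 : (1 < n)%N).

Lemma prefix_cut_x0_inK p m : (n <= m)%N -> inK n (prefix_cut n p (rcons (nseq m false) true)).
Proof.
move=> nm; rewrite /prefix_cut size_rcons size_nseq leqW //.
apply: inK_eq (inK_tens _ [:: (p%:R - (head false (drop n (rcons (nseq m false) true)))%:R, nseq n false)]
  (pword (drop n (rcons (nseq m false) true))) _).
  move=> f; rewrite ev_tensp !ev1 mul1r -cats1 takel_cat ?size_nseq //.
  by rewrite take_nseq.
by apply: kerLP; [rewrite allsz_word size_nseq | apply: inL_x0].
Qed.

Lemma cuts_false_x0x1_inK m : inK n (cuts n false (rcons (nseq m false) true)).
Proof.
elim: m => [|m IH]; first by rewrite /= /prefix_cut /= leqNgt n2; apply: inK_nil.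
rewrite -[rcons _ _]/(false :: rcons (nseq m false) true) [cuts _ _ _]/=.
apply: inK_cat; first exact: inK_mapr.
rewrite -[false :: _]/(rcons (nseq m.+1 false) true).
case: (leqP n m.+1) => nm; first exact: prefix_cut_x0_inK.
rewrite /prefix_cut size_rcons size_nseq; case: leqP => nm'; last exact: inK_nil.
(* The cut exhausts the word, so its right neighbour is the final x0, equal to the left one, and the
   coefficient vanishes. *)
have -> : n = m.+2 by lia.
apply: inK_eq (inK_nil _) => f; rewrite drop_oversize ?size_rcons ?size_nseq //.
by rewrite ev1 ev_nil subrr mul0r.
Qed.

(** Single zeta values are primitive modulo products: shorter prefixes are powers of x0, hence
    products, and cuts starting later vanish by [cuts_false_x0x1_inK]. *)
Lemma cuts_x0x1 m : (0 < m)%N -> eqK n (cuts n true (rcons (nseq m false) true))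
  (if n == m.+1 then [:: (1, (rcons (nseq m false) true, [::]))] else [::]).
Proof.
case: m => // m _; apply: eqK_trans (prefix_cut n true (rcons (nseq m.+1 false) true)) _ _ _.
  apply: inK_eq (inK_mapr _ (fun w => pword (false :: w)) _ (cuts_false_x0x1_inK m)) => f.
  by rewrite ev_tsub ev_cat addrK.
case: (ltngtP n m.+2) => nm.
- by apply: eqK_inK; apply: prefix_cut_x0_inK.
- by apply: eqK_teq => f; rewrite /prefix_cut size_rcons size_nseq leqNgt nm.
apply: eqK_teq => f; rewrite /prefix_cut size_rcons size_nseq nm leqnn.
by rewrite drop_oversize ?take_oversize ?size_rcons ?size_nseq // subr0.
Qed.
End DepthOne.

(** The word of zeta(2,..,2) has no pair x0 x0 to remove, so every coefficient is zero. *)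
Lemma cuts_alt_inK n m : odd n -> inK n (cuts n true (alt false m.*2)).
Proof.
move=> on; apply: inK_seq => -[c [s q]] He.
have k23 : idx23 (nseq m 2%N) by apply/allP => x /nseqP[->].
have [A R _] := blocks23_iw _ false k23.
have R0 : reps true (iw (nseq m 2%N)) = 0%N.
  by rewrite R; apply/count_memPn/negP => /nseqP[].
rewrite alt_even in He.
case: (cuts_entry _ _ _ _ _ on A He) => /= [->|[_ _ _]].
  by apply: inK_eq (inK_nil _) => f; rewrite ev1 ev_nil mul0r.
by rewrite R0; case=> [[]|]; lia.
Qed.

Lemma sumn_idx2 k m : Fidx 0 k -> sumn k = m.*2 -> k = nseq m 2%N.
Proof.
elim: k m => [|i k IH] [|m] //=; rewrite /Fidx /=.
- by case/andP=> /andP[/orP[] /eqP -> _ _].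
case/andP=> /andP[/orP[] /eqP -> k23]; last by lia.
by rewrite add0n => kl [sk]; rewrite [in LHS](IH m) // /Fidx k23.
Qed.

(** The case l = 1 of [cut_form_cuts]: F_(-1) = 0 removes the second summand, and F_0 in weight 2m
    is spanned by zeta(2,..,2). *)
Lemma cuts_one3 t m w k : (0 < t)%N -> one3_zeta t -> w = iw k -> Fidx 1 k ->
  sumn k = (m.*2 + (2 * t + 1))%N ->
  exists c, eqK (2 * t + 1) (cuts (2 * t + 1) true w)
    (tensp (zeta_lift (2 * t + 1)) [:: (c, alt false m.*2)]).
Proof.
move=> t0 Z -> Fk sk; have [e [s [He Hs K]]] := cut_form_cuts t 1 m.*2 t0 Z 1 k Fk sk.
exists (\sum_(x <- e) x.1).
have {}Hs : s = [::].
  case: s Hs {K} => // x s /(_ x (mem_head _ _)) [_] /andP[_]; lia.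
apply: eqK_trans _ (eqK_trans _ _ _ _ K _).
  by apply: eqK_teq => f; rewrite ev_tscale mul1r.
apply: eqK_teq => f; rewrite Hs cats0 !ev_tensp !ev_pword ev_iota_lin ev1 big_distrl.
apply: eq_big_seq => x /He /andP[Fx /eqP sx].
by rewrite (sumn_idx2 _ _ Fx sx) alt_even.
Qed.

Lemma eqK_inK_l n t u : eqK n t u -> inK n u -> inK n t.
Proof.
by move=> H K; apply: inK_eq (inK_cat _ _ _ H K) => f; rewrite ev_cat ev_tsub subrK.
Qed.

Lemma size_zeta_word n : (0 < n)%N -> size (iw [:: n]) = n.
Proof. by move=> n0; rewrite /iw /= cats0 size_rcons size_nseq prednK. Qed.

(* Subtracting from zeta(2,..,2,3,2,..,2) a combination of the products
   zeta(2t+1) zeta(2,..,2) gives an element killed by every D_(2t+1). *)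
Lemma one3_zeta_holds : KernelConjecture -> forall r, (0 < r)%N -> one3_zeta r.
Proof.
move=> KC; elim/ltn_ind => r IH r0 a c acr.
set k := nseq a 2%N ++ 3%N :: nseq c 2%N; set w0 := iw k.
have Fk : Fidx 1 k.
  rewrite /Fidx all_cat /= count_cat /= !count_nseq /= !mul0n.
  by rewrite !all_nseq !orbT.
have sk : sumn k = (2 * r + 1)%N by rewrite sumn_cat /= !sumn_nseq; lia.
pose z t := iw [:: (2 * t + 1)%N]; pose v t := alt false (r - t).*2.
(* [C t] is the coefficient given by [cuts_one3], which applies by the induction hypothesis at t <
   r. For t = 0 no D_(2t+1) has to be matched, and it is set to 0. *)
have [C HC] : exists C : 'I_r -> rat, forall t : 'I_r, (t == 0 :> nat -> C t = 0) /\
    (0 < t -> eqK (2 * t + 1) (cuts (2 * t + 1) true w0)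
       (tensp (pword (z t)) [:: (C t, v t)]))%N.
  apply: (@fin_all_exists _ _ (fun (t : 'I_r) x => (t == 0 :> nat -> x = 0) /\
    (0 < t -> eqK (2 * t + 1) (cuts (2 * t + 1) true w0)
       (tensp (pword (z t)) [:: (x, v t)]))%N)) => t.
  case: (posnP t) => [->|t0]; first by exists 0.
  have skt : sumn k = ((r - t).*2 + (2 * t + 1))%N.
    by rewrite sk; have := ltn_ord t; lia.
  have [x Hx] := cuts_one3 t (r - t) w0 k t0 (IH t (ltn_ord t) t0) erefl Fk skt.
  by exists x; split=> //; rewrite eqn0Ngt t0.
pose prods := flatten [seq pscale (- C t) (shuffle (pword (z t)) (pword (v t)))
  | t : 'I_r <- enum 'I_r].
have sz t : size (z t) = (2 * t + 1)%N by rewrite size_zeta_word // addn1.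
have Lprods : inL prods.
  apply: ideal_flatten => t _; apply: ideal_scale; apply: inL_prod; apply: posw_word.
    by rewrite sz addn1.
  by rewrite size_alt double_gt0 subn_gt0.
have Hprods : allsz (2 * r + 1) prods.
  apply: allsz_flatten => t _.
  have -> : (2 * r + 1 = (2 * t + 1) + (r - t).*2)%N by have := ltn_ord t; lia.
  by rewrite allsz_scale; apply: allsz_shuffle; rewrite allsz_word ?sz ?size_alt.
have sw0 : size w0 = (2 * r + 1)%N.
  by case: (blocks23_iw k false _) => [|_ _ ->//]; case/andP: Fk.
pose u := pword w0 ++ prods.
have Hu : allsz (2 * r + 1) u by rewrite allsz_cat allsz_word sw0 eqxx.
have r2 : (2 <= 2 * r + 1)%N by lia.
have [] := KC _ r2 u (allsz_homog _ _ Hu).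
case.
  move=> t0 /andP[t1 tr]; apply: inK_Kn; apply: eqK_inK_l (Dodd_mod t0 u) _.
  set n := (2 * t0 + 1)%N.
  have on : odd n by rewrite /n; lia.
  have n2 : (1 < n)%N by rewrite /n; lia.
  have n0 := ltnW n2.
  have t0r : (t0 < r)%N by lia.
  have t00 : (0 < t0)%N by lia.
  pose ot0 := Ordinal t0r.
  (* By the derivation property, and since the cuts of [v t] vanish, only the cuts of [z t]
     contribute; as zeta(2t+1) is primitive, only t = t0 survives. *)
  pose Dt (t : 'I_r) := tscale (- C t)
    (if t == ot0 then tensp (pword (z t)) (pword (v t)) else [::]).
  have E1 : eqK n (cuts_lin n prods) (flatten [seq Dt t | t : 'I_r <- enum 'I_r]).
    apply: eqK_trans (eqK_flatten _ _ (fun t : 'I_r => tscale (- C t)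
      (flatten [seq cuts n true w | w <- shw (z t) (v t)])) _ _ _).
      apply: eqK_teq => f; rewrite ev_cuts_lin !ev_flatten; apply: eq_bigr => t _.
      by rewrite ev_pscale ev_tscale ev_shuffle !ev_pword ev_flatten.
    move=> t _; rewrite /Dt.
    case: (posnP t) => [/eqP tz|tp].
      have [-> // _] := HC t.
      by apply: eqK_teq => f; rewrite !ev_tscale oppr0 !mul0r.
    apply: eqK_scale; apply: eqK_trans (cuts_shuffle n n0 true (z t) (v t)) _.
    rewrite -[X in eqK _ _ X]cats0; apply: eqK_cat; last first.
      by apply: eqK_inK; apply: inK_mapr; apply: cuts_alt_inK.
    have ztE : z t = rcons (nseq (2 * t) false) true by rewrite /z /iw /= cats0 addn1.
    have t2 : (0 < 2 * t)%N by lia.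
    rewrite [X in cuts _ _ X]ztE; apply: eqK_trans (eqK_mapr _ _ _ _ (cuts_x0x1 n n2 (2 * t) t2)) _.
    have -> : (n == (2 * t).+1) = (t == ot0) by rewrite -val_eqE /= /n; lia.
    apply: eqK_teq => f; case: eqP => _; last by rewrite ev_mapr !ev_nil.
    by rewrite ev_mapr ev1 mul1r ev_shuffle !ev_pword sum_shw0s ev_tensp !ev_pword ztE.
  have [_ /(_ t00) E2] := HC ot0.
  apply: eqK_inK_l (eqK_trans _ _ _ _ _ (eqK_cat _ _ _ _ _ E2 E1)) _.
    by apply: eqK_teq => f; rewrite ev_cuts_lin [in LHS]ev_cat ev_pword ev_cat ev_cuts_lin.
  apply: inK_eq (inK_nil n) => f.
  rewrite ev_nil ev_cat ev_tensp ev_pword ev1 ev_flatten big_enum (bigD1 ot0) //= big1.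
    by rewrite /Dt eqxx ev_tscale ev_tensp !ev_pword; ring.
  by move=> t /negbTE tt; rewrite /Dt tt ev_tscale ev_nil mulr0.
(* Relations in Z hold in L, where [prods] vanishes as well, so the multiple [d] found for [u]
   serves for the word itself. *)
move=> d Hd _; exists d.
have Hd' : inL (psub u (pscale d (zeta_lift (2 * r + 1)))).
  case: Hd => s [Hs E]; exists s; split=> // x /Hs; by left.
apply: ideal_eq (ideal_cat _ _ _ Hd' (ideal_scale _ (-1) _ Lprods)) => f.
by rewrite ev_cat !ev_psub ev_cat !ev_pscale; ring.
Qed.

Theorem mainTheorem19 :
  KernelConjecture ->
  forall (r l N : nat), (1 <= r)%N -> (1 <= l)%N -> (2 * r + 1 <= N)%N ->
  forall xi : ncpoly, inFN l%:Z N xi ->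
  (* D_{2r+1}(xi) in L_{2r+1} (x) F_{l-1} Z_{2,3} *)
  (exists s : seq (ncpoly * seq nat),
     LtensF_ok (2 * r + 1) (l%:Z - 1) s /\
     Kn (2 * r + 1) (tsub (Dodd r xi) (LtensF (2 * r + 1) (l%:Z - 1) s))) /\
  (* D_{2r+1}(xi) in Q zeta_{2r+1} (x) (F_{l-1} Z_{2,3})_{N-2r-1}
                     + L_{2r+1} (x) F_{l-2} Z_{2,3} *)
  (exists (eta : ncpoly) (s : seq (ncpoly * seq nat)),
     inFN (l%:Z - 1) (N - (2 * r + 1)) eta /\
     LtensF_ok (2 * r + 1) (l%:Z - 2) s /\
     Kn (2 * r + 1)
       (tsub (tsub (Dodd r xi) (tensp (zeta_lift (2 * r + 1)) eta))
             (LtensF (2 * r + 1) (l%:Z - 2) s))).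
Proof.
move=> KC r l N r0 l0 rN xi [x [Hx ->]].
have Z := one3_zeta_holds KC r r0.
have [e [s [He Hs K]]] : cut_form r l (N - (2 * r + 1)) (Dodd r (iota_lin x)).
  apply: cut_form_eqK (Dodd_mod r _) _.
  rewrite /cuts_lin -map_comp; elim: x Hx => [|y x IH] Hx /=; first exact/cut_form_inK/inK_nil.
  apply: cut_form_cat; last by apply: IH => y' Hy'; apply: Hx; rewrite inE Hy' orbT.
  have /andP[Fy /eqP sy] := Hx y (mem_head _ _).
  by apply: cut_form_cuts => //; rewrite sy subnK.
split; last first.
  exists (iota_lin e), s; split; first by exists e.
  split=> //; apply: inK_Kn; apply: inK_eq K => f.
  by rewrite !ev_tsub ev_cut_form ev_tensp ev_pword ev_iota_lin; ring.
(* The first assertion comes from the same decomposition: scalars move into the left factor, and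
   F_(l-2) is contained in F_(l-1). *)
exists ([seq (pscale y.1 (zeta_lift (2 * r + 1)), y.2) | y <- e] ++ s); split.
  move=> y; rewrite mem_cat => /orP[/mapP[y' /He /andP[Fy _] ->]|/Hs [H1 /andP[H2 H3]]] /=.
    split=> //; apply: allsz_homog; rewrite allsz_scale allsz_word size_zeta_word ?addn1 //.
  by split=> //; rewrite /Fidx H2; apply: le_trans H3 _; lia.
apply: inK_Kn; apply: inK_eq K => f.
rewrite !ev_tsub ev_cut_form /LtensF map_cat /tsum map_cat flatten_cat ev_cat.
congr (_ - (_ + _)); rewrite -!map_comp ev_flatten; apply: eq_bigr => y _ /=.
by rewrite ev_tensp ev_pscale !ev_pword.
Qed.
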